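(* Let $q\in\mathbb N$. On a two-step nilpotent Lie group $G(j)$, endowed with the left invariant metric $g(j)$, each curvature invariant of order $2q$ can be expressed as a linear combination of polynomial invariants of $j$ of the form $I_{k_1\ldots k_\lambda|\ldots|k_\mu\ldots k_{2q}}(j)$.
   Context: Let $\mathfrak v=\mathbb R^m$, $\mathfrak z=\mathbb R^r$ carry the standard inner products. Given a linear map $j:\mathfrak z\to\mathfrak{so}(\mathfrak v)$, $Z\mapsto j_Z$, let $\mathfrak g(j)$ be the two-step nilpotent metric Lie algebra with underlying vector space $\mathfrak v\oplus\mathfrak z$, standard inner product, and bracket defined by: $\mathfrak z$ is central, $[\mathfrak v,\mathfrak v]\subseteq\mathfrak z$, and $\langle j_ZX,Y\rangle=\langle Z,[X,Y]\rangle$ for $X,Y\in\mathfrak v$, $Z\in\mathfrak z$. Let $G(j)$ be the simply connected Lie group with Lie algebra $\mathfrak g(j)$, endowed with the left invariant Riemannian metric $g(j)$ given by this inner product at the identity. Let $\{Z_1,\dots,Z_r\}$ be an orthonormal basis of $\mathfrak z$. For $q\in\mathbb N$ and each tuple $(k_1,\dots,k_{2q})$ arising as a permutation of $(1,1,2,2,\dots,q,q)$, divided into consecutive subtuples $(k_1,\dots,k_\lambda),\dots,(k_\mu,\dots,k_{2q})$, define $$I_{k_1\ldots k_\lambda|\ldots|k_\mu\ldots k_{2q}}(j):=\sum\mathrm{Tr}(j_{Z_{\alpha_{k_1}}}\cdots j_{Z_{\alpha_{k_\lambda}}})\cdots\mathrm{Tr}(j_{Z_{\alpha_{k_\mu}}}\cdots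 j_{Z_{\alpha_{k_{2q}}}}),$$ where the sum runs over all $(\alpha_1,\dots,\alpha_q)\in\{1,\dots,r\}^q$ (so there are $r^q$ summands). A curvature invariant is a polynomial in the coefficients of the Riemannian curvature tensor $R$ and its covariant derivatives $\nabla R,\nabla^2R,\dots$, taken with respect to an orthonormal basis of the tangent space at the point under consideration, which is invariant under changes of the orthonormal basis. It has order $k$ if it is a sum of terms each involving a total of $k$ derivatives of the metric, where each occurrence of $R$ (or its contractions) counts as two and each occurrence of $\nabla$ adds one. On the homogeneous space $(G(j),g(j))$ each curvature invariant is a constant function. *)

(* Defs.v *)
From HB Require Import structures.
From mathcomp Require Export all_boot all_order all_algebra.
From mathcomp Require Export all_classical all_reals all_analysis.
(* The notations of mpoly clash with those of MathComp-Analysis: [mpoly n R]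
   stands for the polynomial ring in n variables over R. *)
From mathcomp Require Export -(notations) mpoly.
Export numFieldNormedType.Exports.

Set Implicit Arguments.
Unset Strict Implicit.
Unset Printing Implicit Defensive.

Import Order.TTheory GRing.Theory Num.Theory.
Local Open Scope ring_scope.

Section Dot.
Variable R : realType.

Definition dot n (u v : 'cV[R]_n) : R := \sum_i u i 0 * v i 0.

Definition orthonormal n (Z : 'I_n -> 'cV[R]_n) : Prop :=
  forall a b, dot (Z a) (Z b) = (a == b)%:R.

Lemma dotC n (u v : 'cV[R]_n) : dot u v = dot v u.
Proof. by apply: eq_bigr => i _; rewrite mulrC. Qed.

Lemma dotDr n (u v w : 'cV[R]_n) : dot u (v + w) = dot u v + dot u w.
Proof. by rewrite -big_split; apply: eq_bigr => i _; rewrite mxE mulrDr. Qed.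

Lemma dotZr n c (u v : 'cV[R]_n) : dot u (c *: v) = c * dot u v.
Proof. by rewrite mulr_sumr; apply: eq_bigr => i _; rewrite mxE mulrCA. Qed.

Lemma dot0r n (u : 'cV[R]_n) : dot u 0 = 0.
Proof. by rewrite /dot big1 // => i _; rewrite mxE mulr0. Qed.

Lemma dot_mull n (A : 'M[R]_n) (u v : 'cV[R]_n) :
  dot (A *m u) v = dot u (A^T *m v).
Proof.
have dE x y : dot x y = (x^T *m y) 0 0 :> R.
  by rewrite mxE; apply: eq_bigr => i _; rewrite mxE.
by rewrite !dE trmx_mul mulmxA.
Qed.

End Dot.

(* Riemannian geometry in a global chart.  A metric on R^n is given by its Gram
   matrices in the coordinate frame.  Curvature is local and every germ of a
   metric extends to R^n, so these metrics realize all possible values of the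
   curvature tensor and its covariant derivatives at a point. *)
Section Riemann.
Variables (R : realType) (n : nat).
Implicit Types (g : 'cV[R]_n -> 'M[R]_n) (p u v w : 'cV[R]_n).
Implicit Types (X Y Z : 'cV[R]_n -> 'cV[R]_n) (vs : seq 'cV[R]_n).
Implicit Types (b : 'M[R]_n).

(* C^oo: all iterated directional derivatives are (Frechet) differentiable. *)
Definition smooth (g : 'cV[R]_n -> 'M[R]_n) : Prop :=
  forall vs p, differentiable (foldr (fun v h => 'D_v h) g vs) p.

Definition ip g p u v : R := (u^T *m g p *m v) 0 0.

Definition riemannian g : Prop :=
  smooth g /\
  forall p, (g p)^T = g p /\ forall v, v != 0 -> 0 < ip g p v v.

(* <nabla_u v, w> for constant vector fields u, v, w (Koszul's formula). *)
Definition koszul g p u v w : R :=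
  2^-1 * ('D_u (fun x => ip g x v w) p + 'D_v (fun x => ip g x u w) p
          - 'D_w (fun x => ip g x u v) p).

Definition christoffel g p u v : 'cV[R]_n :=
  invmx (g p) *m \col_k koszul g p u v (delta_mx k 0).

(* The Levi-Civita connection on vector fields. *)
Definition cov g X Y : 'cV[R]_n -> 'cV[R]_n :=
  fun p => 'D_(X p) Y p + christoffel g p (X p) (Y p).

Definition lie X Y : 'cV[R]_n -> 'cV[R]_n :=
  fun p => 'D_(X p) Y p - 'D_(Y p) X p.

Definition curvature g X Y Z : 'cV[R]_n -> 'cV[R]_n :=
  fun p => cov g X (cov g Y Z) p - cov g Y (cov g X Z) p
           - cov g (lie X Y) Z p.

(* A covariant tensor field is encoded by its values on lists of tangent
   vectors at a point; only lists whose length is the rank are meaningful. *)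
Definition tensor : Type := 'cV[R]_n -> seq 'cV[R]_n -> R.

(* By tensoriality, tangent vectors may be extended to constant fields. *)
Definition riem g : tensor := fun p vs =>
  if vs is [:: u; v; w; z]
  then ip g p (curvature g (cst u) (cst v) (cst w) p) z else 0.

(* (nabla_u T)(v_1, .., v_k); the first argument is the direction u. *)
Definition covd g (T : tensor) : tensor := fun p us =>
  if us is u :: vs then
    'D_u (fun x => T x vs) p
    - \sum_(i < size vs)
        T p (set_nth 0 vs i (cov g (cst u) (cst (nth 0 vs i)) p))
  else 0.

Definition nabla_riem g (k : nat) : tensor := iter k (covd g) (riem g).

(* The columns of b are an orthonormal basis of the tangent space at p. *)
Definition onb g p b : Prop := b^T *m g p *m b = 1%:M.

(* The coefficients of R, nabla R, .., nabla^(K-1) R: the variable (k, t) is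
   the coefficient of nabla^k R with index tuple t. *)
Definition curv_var (K : nat) : finType :=
  {k : 'I_K & (4 + k).-tuple 'I_n}%type.

Definition curv_coef K g p b (x : curv_var K) : R :=
  nabla_riem g (tag x) p [seq col i b | i <- tagged x].

Definition curv_eval K (P : mpoly #|curv_var K| R) g p b : R :=
  meval (fun i => curv_coef g p b (enum_val i)) P.

Definition curvature_invariant K (P : mpoly #|curv_var K| R) : Prop :=
  forall g, riemannian g -> forall p b b', onb g p b -> onb g p b' ->
  curv_eval P g p b = curv_eval P g p b'.

(* nabla^k R involves k + 2 derivatives of the metric. *)
Definition has_order K (P : mpoly #|curv_var K| R) (d : nat) : Prop :=
  forall mon, mon \in msupp P ->
  (\sum_i mon i * (2 + tag (enum_val i : curv_var K)))%N = d.

End Riemann.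

Section TwoStep.
Variables (R : realType) (m r : nat).
Implicit Types (j : {linear 'cV[R]_r -> 'M[R]_m}) (x y p : 'cV[R]_(m + r)).

Definition so_valued j : Prop := forall Z, (j Z)^T = - j Z.

(* The bracket of g(j) on R^m (+) R^r. *)
Definition br j x y : 'cV[R]_(m + r) :=
  col_mx 0 (\col_a dot (j (delta_mx a 0) *m usubmx x) (usubmx y)).

Lemma br_centralr j x y : usubmx y = 0 -> br j x y = 0.
Proof.
move=> y0; rewrite /br y0 -[RHS]vsubmxK linear0; congr col_mx.
by apply/colP => a; rewrite !mxE dot0r.
Qed.

Lemma brDr j x y y' : br j x (y + y') = br j x y + br j x y'.
Proof.
rewrite /br add_col_mx addr0; congr col_mx.
by apply/colP => a; rewrite !mxE linearD dotDr.
Qed.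

Lemma brZr j c x y : br j x (c *: y) = c *: br j x y.
Proof.
rewrite /br scale_col_mx scaler0; congr col_mx.
by apply/colP => a; rewrite !mxE linearZ dotZr.
Qed.

Lemma br_skew j x y : so_valued j -> br j x y = - br j y x.
Proof.
move=> soj; rewrite /br opp_col_mx oppr0; congr col_mx.
apply/colP => a; rewrite !mxE dot_mull dotC soj mulNmx -scaleN1r.
by rewrite [LHS]dotC dotZr mulN1r dotC.
Qed.

Lemma brP j (X Y : 'cV[R]_m) (Z : 'cV[R]_r) :
  dot (j Z *m X) Y = dot Z (dsubmx (br j (col_mx X 0) (col_mx Y 0))).
Proof.
rewrite /br col_mxKd !col_mxKu.
have -> : j Z = \sum_a Z a 0 *: j (delta_mx a 0).
  rewrite {1}(matrix_sum_delta Z) linear_sum; apply: eq_bigr => a _.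
  by rewrite big_ord1 linearZ.
rewrite mulmx_suml /dot; under eq_bigr do rewrite summxE mulr_suml.
rewrite exchange_big /=; apply: eq_bigr => a _; rewrite mxE mulr_sumr.
by apply: eq_bigr => i _; rewrite -scalemxAl mxE mulrA.
Qed.

(* G(j) in exponential coordinates: by the Baker-Campbell-Hausdorff formula,
   the simply connected Lie group of a two-step nilpotent Lie algebra is the
   underlying vector space with the product x + y + [x, y] / 2; the unit is 0
   and the inverse of x is - x. *)
Definition gmul j x y : 'cV[R]_(m + r) := x + y + 2^-1 *: br j x y.

Lemma gmulA j : so_valued j -> associative (gmul j).
Proof.
move=> soj x y z; have skew u v := br_skew u v soj.
have ubr u v : usubmx (br j u v) = 0 by rewrite col_mxKu.
have brl u v w : br j (br j u v) w = 0 by rewrite skew br_centralr ?oppr0.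
have brDl u v w : br j (u + v) w = br j u w + br j v w.
  by rewrite skew brDr opprD -!skew.
have brZl c u w : br j (c *: u) w = c *: br j u w.
  by rewrite skew brZr -scalerN -skew.
have brr u v w : br j u (br j v w) = 0 by rewrite br_centralr.
rewrite /gmul !(brDl, brDr, brZl, brZr) brl brr !(scaler0, addr0) !scalerDr.
by rewrite !addrA [LHS](+%R).[ACl 1 * 2 * 5 * 3 * 6 * 4].
Qed.

Lemma gmulN j x : so_valued j -> gmul j (- x) x = 0.
Proof.
move=> soj; rewrite /gmul addNr add0r -scaleN1r br_skew // brZr.
have /eqP : br j x x = - br j x x by apply: br_skew.
rewrite -subr_eq0 opprK -mulr2n -scaler_nat scaler_eq0 pnatr_eq0 => /eqP ->.
by rewrite scaler0 oppr0 scaler0.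
Qed.

(* The left invariant metric which is the standard inner product at the unit,
   i.e. the pull-back of the latter by left translation with p^-1 = - p. *)
Definition gmetric j (p : 'cV[R]_(m + r)) : 'M[R]_(m + r) :=
  \matrix_(a, b) dot ('D_(delta_mx a 0) (gmul j (- p)) p)
                     ('D_(delta_mx b 0) (gmul j (- p)) p).

(* (k_1, .., k_2q) cut into consecutive nonempty subtuples. *)
Definition admissible q (w : seq (seq 'I_q)) : bool :=
  perm_eq (flatten w) (flatten [seq [:: i; i] | i <- enum 'I_q])
  && ([::] \notin w).

Definition trace_inv j (Z : 'I_r -> 'cV[R]_r) q (w : seq (seq 'I_q)) : R :=
  \sum_(alpha : {ffun 'I_q -> 'I_r})
    \prod_(s <- w) \tr (\big[mulmx/1%:M]_(k <- s) j (Z (alpha k))).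

End TwoStep.

(* Main.v *)
From HB Require Import structures.
Require Import Defs.
From mathcomp Require Import ring lra.

Set Implicit Arguments.
Unset Strict Implicit.
Unset Printing Implicit Defensive.

Import Order.TTheory GRing.Theory Num.Theory.
Local Open Scope ring_scope.

(** Left translations are isometries of G(j), so the components of R and of its
    covariant derivatives in the left invariant frame are constant. In the
    exponential chart the frame is given by the affine map theta, and Koszul's
    formula shows that the components of nabla^k R are the universal expressions
    tau k j in the bracket (theta_christoffel, theta_curvature, tau_frame). The
    connection is linear in j, hence these components are homogeneous of degree
    k + 2 in the entries of j (homog_tau), and the value of a curvature
    invariant P of order 2q is a homogeneous polynomial f of degree 2q in j
    (homog_frame_eval).

    For orthogonal matrices A of v and B of z, the map diag(A, B) is an isometry
    from g(j) to the metric Lie algebra of the transformed map Z |-> A j_(B^T Z)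
    A^T. It transforms an orthonormal frame into another one, and P does not
    depend on the frame; therefore f is invariant under O(m) and O(r)
    (frame_eval_isometry), and invariant theory is applied to f, a polynomial on
    a finite dimensional space, instead of to the jets of metrics.

    Invariant polynomials in j are handled by the first fundamental theorem for
    the orthogonal group, in the form: an O(n)-invariant tensor t all of whose
    complete contractions vanish is zero (orthogonal_fft). The proof is by
    induction on the number of slots, contracting pairs of slots, and so reduces
    to traceless tensors of order k > 0. For these the sum of |E_ij t|^2 over
    all matrix units, acting as derivations, is k |t|^2 by invariance under
    rotations, while its diagonal part is at least 2k |t|^2, because by
    invariance under reflections each index value occurs an even number of times
    wherever t is not zero (traceless_invariant_eq0).

    An orthogonal decomposition in the space of coefficient tensors then shows
    that f is a combination of complete contractions of the 2q-th tensor power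
    of j (invariant_form_expressible). Such a contraction pairs the 2q indices
    in z, which gives the labels k_1, .., k_2q, and links the 4q indices in v
    into cycles; as the matrices j_Z are skew, each cycle is, up to sign, the
    trace of a product (closed_edges_traces, pairing_trace_inv). *)

(** * Tensors and their contractions *)

Section Tensors.
Variables (R : realType) (n : nat) (S : finType).
Local Notation idx := {ffun S -> 'I_n}.
Implicit Types (t h : idx -> R) (I J : idx) (A : {set S}) (kap : S -> S).

Definition upd I a x : idx := [ffun s => if s == a then x else I s].

Definition relabel I kap : idx := [ffun s => I (kap s)].

(** A pairing of the slots in A is encoded by a map kap on slots whose fibres in
    A are the pairs: substituting kap makes the indices of a pair equal. *)
Definition perfect A kap :=
  forall v, #|[set s in A | kap s == v]| \in [:: 0; 2]%N.

Definition contract a b t I := \sum_x t (upd (upd I a x) b x).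

(** The matrix unit E_ij acting as a derivation on the slots in A. *)
Definition elem A i j t I := \sum_(a in A | I a == i) t (upd I a j).

Definition act (g : 'M[R]_n) t I :=
  \sum_(J : idx) (\prod_s g (I s) (J s)) * t J.

Lemma updE I a x s : upd I a x s = if s == a then x else I s.
Proof. by rewrite ffunE. Qed.

Lemma upd_id I a x : I a = x -> upd I a x = I.
Proof. by move=> <-; apply/ffunP => s; rewrite updE; case: eqP => [->|]. Qed.

Lemma upd_upd I a x y : upd (upd I a x) a y = upd I a y.
Proof. by apply/ffunP => s; rewrite !updE; case: eqP. Qed.

Lemma updC I a b x y : a != b -> upd (upd I a x) b y = upd (upd I b y) a x.
Proof.
move=> ab; apply/ffunP => s; rewrite !updE.
by case: eqP => [->|//]; rewrite eq_sym (negPf ab).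
Qed.

(** The map (I, x) |-> (upd I a x, I a) is an involution, so that averaging over
    the index in slot a does not change a sum over all index words. *)
Lemma sum_upd a h : \sum_I \sum_x h (upd I a x) = n%:R * \sum_I h I.
Proof.
rewrite pair_big /=.
pose f (p : idx * 'I_n) := (upd p.1 a p.2, p.1 a).
have fK : involutive f.
  by case=> I x; rewrite /f /= upd_upd updE eqxx upd_id.
rewrite (reindex_inj (inv_inj fK)) /=.
under eq_bigr do rewrite upd_upd upd_id //.
rewrite -(pair_bigA _ (fun I _ => h I)) /=.
by under eq_bigr do rewrite sumr_const card_ord; rewrite sumrMnl mulr_natl.
Qed.

Lemma sum_fiber A I (F : S -> 'I_n -> R) :
  \sum_i \sum_(a in A | I a == i) F a i = \sum_(a in A) F a (I a).
Proof.
rewrite (exchange_big_dep (mem A)) /=; last by move=> i a _ /andP[].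
apply: eq_bigr => a aA; rewrite (big_pred1 (I a)) // => i.
by rewrite aA eq_sym.
Qed.

Lemma sum_fiber_card A I : (\sum_i #|[set a in A | I a == i]| = #|A|)%N.
Proof.
rewrite -sum1_card (partition_big I predT) //=; apply: eq_bigr => i _.
by rewrite -sum1_card; apply: eq_bigl => a; rewrite inE.
Qed.

Lemma elem_diag A i t I : elem A i i t I = #|[set a in A | I a == i]|%:R * t I.
Proof.
rewrite /elem (eq_bigr (fun=> t I)) => [|a /andP[_ /eqP]]; last first.
  by move/upd_id->.
rewrite sumr_const mulr_natl; congr (_ *+ _); apply: eq_card => a.
by rewrite inE unfold_in.
Qed.

(** The heart of the first fundamental theorem. Let Q be the sum of all |E_ij
    t|^2. Invariance turns E_ij t into E_ji t in one factor; expanding the two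
    derivations, the terms with two distinct slots are contractions of t, which
    vanish, and the others give Q = #|A| |t|^2. On the other hand E_ii
    multiplies t I by the number of occurrences of i in I on A; where t I != 0
    these numbers are even, hence their squares add up to at least 2 #|A|, and Q
    >= 2 #|A| |t|^2. *)
Lemma traceless_invariant_eq0 A t : A != finset.set0 ->
  (forall i j I, elem A i j t I = elem A j i t I) ->
  (forall I x, t I != 0 -> ~~ odd #|[set a in A | I a == x]|) ->
  (forall a b I, a \in A -> b \in A -> a != b -> contract a b t I = 0) ->
  forall I, t I = 0.
Proof.
move=> /set0Pn[a0 a0A] inv even traceless I0.
have n_gt0 : (0 < n)%N by case: n (I0 a0) => // -[].
pose N := \sum_I t I ^+ 2.
have N_ge0 : 0 <= N by apply: sumr_ge0 => I _; apply: sqr_ge0.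
(* Only the diagonal terms j = i are kept. *)
have lower : 2 * #|A|%:R * N <= \sum_I \sum_i \sum_j elem A i j t I ^+ 2.
  rewrite mulr_sumr; apply: ler_sum => I _.
  apply: (@le_trans _ _ (\sum_i elem A i i t I ^+ 2)); last first.
    apply: ler_sum => i _; rewrite (bigD1 i) //= lerDl.
    by apply: sumr_ge0 => j _; apply: sqr_ge0.
  under eq_bigr do rewrite elem_diag exprMn.
  rewrite -mulr_suml; have [->|tI] := eqVneq (t I) 0.
    by rewrite expr0n /= !mulr0.
  rewrite ler_wpM2r ?sqr_ge0 // -(sum_fiber_card A I) natr_sum mulr_sumr.
  apply: ler_sum => i _; have := even _ i tI.
  case: #|_| => [|[|k]] //= _; first by rewrite mulr0 expr0n.
  by rewrite expr2 ler_wpM2r ?ler0n // ler_nat.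
have upper : \sum_I \sum_i \sum_j elem A i j t I ^+ 2 = #|A|%:R * N.
  transitivity (\sum_I \sum_(a in A) \sum_(b in A)
      t (upd I a (I b)) * t (upd I b (I a))).
    apply: eq_bigr => I _.
    transitivity (\sum_i \sum_(a in A | I a == i) \sum_j
        \sum_(b in A | I b == j) t (upd I a j) * t (upd I b i)).
      apply: eq_bigr => i _; rewrite exchange_big /=; apply: eq_bigr => j _.
      rewrite expr2 {2}inv /elem mulr_suml; apply: eq_bigr => a _.
      by rewrite mulr_sumr.
    under eq_bigr do under eq_bigr do
      rewrite (sum_fiber A _ (fun b j => t (upd _ _ j) * t (upd _ b _))).
    exact: (sum_fiber A _ (fun a i => \sum_(b in A)
              t (upd I a (I b)) * t (upd I b i))).
  rewrite exchange_big mulr_natl -sumr_const /=; apply: eq_bigr => a aA.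
  rewrite exchange_big (bigD1 a) //= [X in _ + X]big1 ?addr0
    => [|b /andP[bA ba]].
    by apply: eq_bigr => I _; rewrite upd_id // -expr2.
  (* Summing over the index in slot a first produces a contraction of t. *)
  have /eqP := sum_upd a (fun I => t (upd I a (I b)) * t (upd I b (I a))).
  rewrite big1 => [|I _].
    by rewrite eq_sym mulf_eq0 pnatr_eq0 gtn_eqF //= => /eqP.
  under eq_bigr do rewrite upd_upd !updE (negPf ba) eqxx.
  by rewrite -mulr_sumr [X in _ * X]traceless ?mulr0 // eq_sym.
have A_gt0 : 0 < #|A|%:R :> R by rewrite ltr0n; apply/card_gt0P; exists a0.
have N0 : N = 0.
  apply/eqP; rewrite eq_le N_ge0 andbT -(pmulr_rle0 _ A_gt0).
  by move: lower; rewrite upper; lra.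
move/eqP: N0; rewrite psumr_eq0 => [/allP/(_ I0)|I _]; last exact: sqr_ge0.
by rewrite mem_index_enum sqrf_eq0 => /(_ isT)/eqP.
Qed.

(** The two correction terms are exchanged by swapping i and j, so that a
    contraction of an infinitesimally invariant tensor is again infinitesimally
    invariant. *)
Lemma elem_contract A a b i j t I : a \in A -> b \in A -> a != b ->
  elem (A :\ a :\ b) i j (contract a b t) I
  = \sum_x elem A i j t (upd (upd I a x) b x)
    - t (upd (upd I a j) b i) - t (upd (upd I a i) b j).
Proof.
move=> aA bA ab.
have split (F : S -> R) : \sum_(s in A) F s =
    F a + F b + \sum_(s in A :\ a :\ b) F s.
  rewrite (big_setD1 a) //= (big_setD1 b) /= ?addrA //.
  by rewrite !inE eq_sym ab.
rewrite /elem /contract exchange_big /=.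
have step x : \sum_(s in A | upd (upd I a x) b x s == i)
      t (upd (upd (upd I a x) b x) s j)
    = (if x == i then t (upd (upd I a j) b i) + t (upd (upd I a i) b j) else 0)
      + \sum_(s in A :\ a :\ b | I s == i) t (upd (upd (upd I s j) a x) b x).
  rewrite !big_mkcondr split !updE eqxx (negPf ab) eqxx; congr (_ + _).
    case: eqP => [->|_]; last by rewrite addr0.
    rewrite upd_upd [in upd (upd (upd _ _ _) _ _) _ _]updC 1?eq_sym //.
    by rewrite upd_upd updC // eq_sym.
  apply: eq_bigr => s; rewrite !inE !updE => /and3P[/negPf sb /negPf sa _].
  rewrite sa sb; case: eqP => // _; congr t.
  apply/ffunP => v; rewrite !updE.
  by case: (eqVneq v s) => [->|//]; rewrite sa sb.
rewrite (eq_bigr _ (fun x _ => step x)) big_split /= -big_mkcond big_pred1_eq.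
by ring.
Qed.

Lemma contract_even A a b t I x : a \in A -> b \in A -> a != b ->
  (forall J y, t J != 0 -> ~~ odd #|[set s in A | J s == y]|) ->
  contract a b t I != 0 -> ~~ odd #|[set s in A :\ a :\ b | I s == x]|.
Proof.
move=> aA bA ab even; apply: contraR => odd_x; apply/eqP/big1 => y _.
apply/eqP; apply: contraTT odd_x => /(even _ x); rewrite negbK.
set J := upd _ _ _.
have -> : #|[set s in A | J s == x]| =
    ((y == x).*2 + #|[set s in A :\ a :\ b | I s == x]|)%N.
  rewrite (cardsD1 a) (cardsD1 b) !inE [b == a]eq_sym ab aA bA !updE !eqxx.
  rewrite (negPf ab) /= addnA addnn; congr (_ + _)%N; apply: eq_card => s.
  by rewrite !inE !updE; case: (s == b); case: (s == a); rewrite ?andbF.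
by rewrite oddD odd_double.
Qed.

(** Induction on the set A of slots that are still uncontracted: contracting two
    slots a and b of A gives a tensor on A minus a and b with the same three
    properties, whose complete contractions are among those of t. By induction
    it is zero, so t is traceless. *)
Lemma perfect_contractions_eq0 A t :
  (forall I J, {in A, I =1 J} -> t I = t J) ->
  (forall i j I, elem A i j t I = elem A j i t I) ->
  (forall I x, t I != 0 -> ~~ odd #|[set a in A | I a == x]|) ->
  (forall kap, {in A, forall s, kap s \in A} -> perfect A kap ->
     \sum_I t (relabel I kap) = 0) ->
  forall I, t I = 0.
Proof.
have [k] := ubnP #|A|; elim: k A t => // k IHk A t; rewrite ltnS => leAk.
move=> dep inv even null.
have [A0|/set0Pn An0] := eqVneq A finset.set0.
  move=> I; have /eqP : \sum_(J : idx) t (relabel J id) = 0.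
    apply: null => [s|v]; first by [].
    rewrite (_ : [set _ in _ | _] = finset.set0) ?cards0 //.
    by apply/setP => s; rewrite A0 !inE.
  rewrite (eq_bigr (fun=> t I)) => [|J _]; last by apply: dep => s;
    rewrite A0 inE.
  rewrite sumr_const -mulr_natl mulf_eq0 pnatr_eq0.
  move=> /orP[/eqP/card0_eq/(_ I)|/eqP//].
  by rewrite inE.
apply: (@traceless_invariant_eq0 A) => // [|a b I aA bA ab]; first exact/set0Pn.
apply: (IHk (A :\ a :\ b)) => [|I1 I2 eqI|i j I1|I1 x|kap kapA perf] //.
- apply: leq_trans leAk; rewrite [ltnRHS](cardsD1 a) aA ltnS.
  by apply/subset_leq_card/fintype.subsetP => s;
    rewrite !inE => /and3P[_ -> ->].
- apply: eq_bigr => x _; apply: dep => s sA; rewrite !updE.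
  case: eqVneq => // sb; case: eqVneq => // sa.
  by apply: eqI; rewrite !inE sa sb sA.
- rewrite !elem_contract // (eq_bigr _ (fun x _ => inv i j _)).
  by rewrite -!addrA; congr (_ + _); rewrite addrC.
- exact: contract_even.
(* The variable a serves as the common index of the new pair a, b. *)
pose kap' s := if (s == a) || (s == b) then a else kap s.
have kapa s : s \in A -> s != a -> s != b -> kap s \in A :\ a :\ b.
  by move=> sA sa sb; apply: kapA; rewrite !inE sA sa sb.
rewrite /contract.
have -> : \sum_(I0 : idx) \sum_x t (upd (upd (relabel I0 kap) a x) b x)
   = n%:R * \sum_I t (relabel I kap').
  rewrite -(sum_upd a); apply: eq_bigr => J _; apply: eq_bigr => x _.
  apply: dep => s sA; rewrite !updE !ffunE /kap'.
  case: (eqVneq s b) => [_|sb]; first by rewrite orbT eqxx.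
  case: (eqVneq s a) => [_|sa] /=; first by rewrite eqxx.
  by have := kapa _ sA sa sb; rewrite !inE => /and3P[_ /negPf->].
rewrite null ?mulr0 // => [s sA|v]; rewrite /kap'.
  case: (eqVneq s a) => // sa; case: (eqVneq s b) => // sb.
  by have := kapa _ sA sa sb; rewrite !inE => /and3P[].
have [->|va] := eqVneq v a.
  rewrite (_ : [set _ in _ | _] = [set a; b]) ?cards2 ?ab //.
  apply/setP => s; rewrite !inE; case: (eqVneq s a) => [->|sa] /=.
    by rewrite aA eqxx.
  case: (eqVneq s b) => [->|sb]; first by rewrite bA eqxx.
  apply/negbTE/negP => /andP[sA /eqP sk].
  by have := kapa _ sA sa sb; rewrite sk !inE eqxx andbF.
have -> : [set s in A | (if (s == a) || (s == b) then a else kap s) == v]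
          = [set s in A :\ a :\ b | kap s == v]; last exact: perf.
apply/setP => s; rewrite !inE.
case: (eqVneq s a) => [_|sa] /=; first by rewrite eq_sym (negPf va) !andbF.
by case: (eqVneq s b) => [_|sb] //=; rewrite eq_sym (negPf va) !andbF.
Qed.

End Tensors.

(** * The first fundamental theorem for the orthogonal group *)

Section Orthogonal.
Variables (R : realType) (n : nat) (S : finType).
Local Notation idx := {ffun S -> 'I_n}.
Implicit Types (t : idx -> R) (I J : idx).

Definition orthogonal_mx k (g : 'M[R]_k) := g^T *m g = 1%:M.

Lemma trmxZ k l a (A : 'M[R]_(k, l)) : (a *: A)^T = a *: A^T.
Proof. by apply/matrixP => x y; rewrite !mxE. Qed.

(** For X = E_ij - E_ji this is the rotation whose half angle has tangent s, in
    its rational parametrization. *)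
Lemma rotation_orthogonal k (X : 'M[R]_k) (s : R) :
  X^T = - X -> X *m X *m X = - X ->
  orthogonal_mx ((1 + s ^+ 2)^-1 *:
    ((1 + s ^+ 2)%:M + (2 * s) *: X + (2 * s ^+ 2) *: (X *m X))).
Proof.
move=> skewX X3; have c_neq0 : 1 + s ^+ 2 != 0.
  by rewrite gt_eqF // ltr_wpDr ?sqr_ge0.
rewrite /orthogonal_mx trmxZ -scalemxAl -scalemxAr scalerA.
set c := 1 + _ in c_neq0 *; set Y := X *m X.
have XY : X *m Y = - X by rewrite mulmxA.
have YY : Y *m Y = - Y by rewrite {1}/Y -mulmxA XY mulmxN.
have tY : Y^T = Y by rewrite trmx_mul skewX mulNmx mulmxN opprK.
have -> : (c%:M + (2 * s) *: X + (2 * s ^+ 2) *: Y)^T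
    = c%:M - (2 * s) *: X + (2 * s ^+ 2) *: Y.
  by rewrite !linearD /= !trmxZ tr_scalar_mx skewX tY scalerN.
rewrite !(mulmxDl, mulmxDr, mulNmx) !mul_scalar_mx !mul_mx_scalar.
rewrite -!scalemxAl -!scalemxAr X3 -/Y XY YY.
apply/matrixP => x y; rewrite !mxE; case: eqP => _; rewrite ?mulr1n ?mulr0n.
  by rewrite /c in c_neq0 *; field.
by rewrite /c in c_neq0 *; field.
Qed.

Lemma deriv_prod (T : eqType) (r : seq T) (p : T -> {poly R}) : uniq r ->
  (\prod_(s <- r) p s)^`()
  = \sum_(a <- r) (p a)^`() * \prod_(s <- r | s != a) p s.
Proof.
elim: r => [|b r IHr] /=; first by rewrite !big_nil derivC.
case/andP=> br ur; rewrite !big_cons derivM eqxx IHr //; congr (_ + _).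
  congr (_ * _); rewrite [RHS]big_seq_cond [LHS]big_seq.
  apply: eq_bigl => s; case: eqVneq => [->|_]; first by rewrite (negPf br).
  by rewrite andbT.
rewrite mulr_sumr [LHS]big_seq [RHS]big_seq; apply: eq_bigr => a ar.
by rewrite big_cons eq_sym (memPn br a ar) mulrCA.
Qed.

Lemma poly_vanishing_eq0 (p : {poly R}) : (forall s, p.[s] = 0) -> p = 0.
Proof.
move=> p0; apply/eqP/negPn/negP => pn0.
pose rs : seq R := [seq i%:R | i <- iota 0 (size p)].
have roots : all (root p) rs by apply/allP => x _; apply/eqP.
have urs : uniq rs.
  by rewrite map_inj_uniq ?iota_uniq // => i j /eqP; rewrite eqr_nat => /eqP.
by have := max_poly_roots pn0 roots urs; rewrite size_map size_iota ltnn.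
Qed.

(** The product is 1 on the index words that agree with I off the slot a, and 0
    on all others. *)
Lemma sum_close_idx (F : idx -> R) I a :
  \sum_(J : idx) (\prod_(s | s != a) (I s == J s)%:R) * F J
    = \sum_y F (upd I a y).
Proof.
have nz J : \prod_(s | s != a) (I s == J s)%:R = (J == upd I a (J a))%:R :> R.
  case: eqP => [->|neq].
    by apply: big1 => s /negPf sa; rewrite updE sa eqxx.
  apply/eqP/prodf_eq0.
  have [s /andP[sa sne]|eqs] := pickP [pred s | (s != a) && (I s != J s)].
    by exists s => //; rewrite (negPf sne).
  case: neq; apply/ffunP => s; rewrite updE; case: eqVneq => [->//|sa].
  by have := eqs s; rewrite /= sa => /negbFE/eqP->.
rewrite (partition_big (fun J : idx => J a) predT) //=; apply: eq_bigr => y _.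
have upda : upd I a y a = y by rewrite updE eqxx.
rewrite (bigD1 (upd I a y)) ?upda ?eqxx //= [X in _ + X]big1 =>
  [|J /andP[/eqP Ja neq]].
  by rewrite nz upda eqxx mul1r addr0.
by rewrite nz Ja (negPf neq) mul0r.
Qed.

Definition invariant t :=
  forall g : 'M[R]_n, orthogonal_mx g -> forall I, act g t I = t I.

(** Clearing denominators in the invariance under the rational rotations in the
    plane of i and j gives a polynomial identity Q = 0 in the parameter s; its
    derivative at s = 0 is the asserted identity, up to the factor 2. *)
Lemma invariant_elem t i j I : invariant t ->
  elem finset.setT i j t I = elem finset.setT j i t I.
Proof.
move=> inv; have [->//|ij] := eqVneq i j.
pose X : 'M[R]_n := delta_mx i j - delta_mx j i.
have tX : X^T = - X by rewrite linearB /= !trmx_delta opprB.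
have X3 : X *m X *m X = - X.
  rewrite /X !(mulmxBl, mulmxBr) !mul_delta_mx_cond !eqxx (negPf ij).
  rewrite eq_sym (negPf ij) !mulr1n !mulr0n.
  rewrite !(mulmxBl, mulmxBr, mul0mx) !mul_delta_mx_cond !eqxx (negPf ij).
  rewrite eq_sym (negPf ij) !mulr1n !mulr0n.
  by rewrite !subr0 !sub0r opprK opprB addrC.
pose p (x y : 'I_n) : {poly R} :=
  (1 + 'X ^+ 2) * (x == y)%:R%:P + 2%:P * 'X * (X x y)%:P
  + 2%:P * 'X ^+ 2 * ((X *m X) x y)%:P.
pose Q := \sum_(J : idx) (\prod_s p (I s) (J s)) * (t J)%:P
  - (1 + 'X ^+ 2) ^+ #|S| * (t I)%:P.
have Q0 : Q = 0.
  apply: poly_vanishing_eq0 => s; have c_neq0 : 1 + s ^+ 2 != 0.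
    by rewrite gt_eqF // ltr_wpDr ?sqr_ge0.
  rewrite /Q hornerD hornerN horner_sum !hornerE.
  rewrite -(inv _ (rotation_orthogonal s tX X3)) /act mulr_sumr.
  apply/eqP; rewrite subr_eq0; apply/eqP; apply: eq_bigr => J _.
  rewrite hornerM hornerC mulrA; congr (_ * _).
  have -> : (1 + s ^+ 2) ^+ #|S| = \prod_(a : S) (1 + s ^+ 2).
    by rewrite prodr_const.
  rewrite horner_prod -big_split /=; apply: eq_bigr => a _.
  by rewrite /p !hornerE !mxE; case: eqP => _; field.
have : Q^`().[0] = 0 by rewrite Q0 derivC horner0.
have p0 x y : (p x y).[0] = (x == y)%:R.
  by rewrite /p !(hornerD, hornerM, hornerC, hornerX) /=; ring.
have dp0 x y : (p x y)^`().[0] = 2 * X x y.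
  by rewrite /p !poly.derivE !(hornerD, hornerM, hornerC, hornerX) /=; ring.
rewrite derivB hornerD hornerN [X in _ - X](_ : _ = 0) ?subr0; last first.
  rewrite derivM derivC mulr0 addr0 deriv_exp derivD -polyC1 derivC add0r.
  rewrite derivXn hornerM hornerMn hornerM hornerMn hornerX.
  by rewrite !(mul0rn, mul0r).
rewrite raddf_sum horner_sum /=.
under eq_bigr => J _ do rewrite derivM derivC mulr0 addr0
  deriv_prod ?index_enum_uniq // hornerM hornerC horner_sum mulr_suml.
rewrite exchange_big /=.
under eq_bigr => a _.
  under eq_bigr => J _.
    rewrite hornerM dp0 horner_prod.
    under eq_bigr do rewrite p0.
    rewrite mulrAC mulrC.
    over.
  rewrite sum_close_idx.
  over.
have elemE k l : elem finset.setT k l t I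
    = \sum_a \sum_y delta_mx k l (I a) y * t (upd I a y).
  rewrite /elem big_mkcond /=; apply: eq_bigr => a _.
  rewrite inE /= (bigD1 l) //= [X in _ + X]big1 => [|y /negPf yl].
    by rewrite !mxE eqxx andbT addr0; case: eqP; rewrite ?mul1r ?mul0r.
  by rewrite !mxE yl andbF mul0r.
move=> sum0; apply/eqP; rewrite -subr_eq0 !elemE -sumrB.
apply/eqP; apply: (@mulfI _ 2);
  rewrite ?pnatr_eq0 // mulr0 -[RHS]sum0 mulr_sumr.
apply: eq_bigr => a _; rewrite -sumrB mulr_sumr; apply: eq_bigr => y _.
by rewrite updE eqxx /X !mxE; ring.
Qed.

(** The reflection in the coordinate x multiplies t I by (-1)^k, where k is the
    number of occurrences of x in I. *)
Lemma invariant_even t I x : invariant t -> t I != 0 ->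
  ~~ odd #|[set s in finset.setT | I s == x]|.
Proof.
move=> inv; apply: contraNN => oddx.
pose d : 'rV[R]_n := \row_y (if y == x then -1 else 1).
have orth : orthogonal_mx (diag_mx d).
  rewrite /orthogonal_mx tr_diag_mx mulmx_diag -[1%:M]diag_const_mx.
  congr diag_mx; apply/rowP => y; rewrite !mxE.
  by case: eqP; rewrite ?mulrNN mulr1.
have := inv _ orth I; rewrite /act (bigD1 I) //= [X in _ + X]big1 ?addr0 =>
  [|J neq].
  rewrite (eq_bigr (fun s => if I s == x then -1 else 1)) => [|s _]; last first.
    by rewrite !mxE eqxx.
  rewrite -big_mkcond prodr_const (eq_card (B :=
    [set s in finset.setT | I s == x])) => [|s].
    rewrite -signr_odd oddx expr1 mulN1r => /eqP; rewrite -subr_eq0.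
    by rewrite -opprD oppr_eq0 -mulr2n mulrn_eq0.
  by rewrite !inE.
have [a Ia] : exists a, I a != J a.
  by apply/existsP; rewrite -negb_forall; apply: contra neq => /forallP eqIJ;
     apply/eqP/ffunP => a; apply/esym/eqP.
by rewrite (bigD1 a) //= mxE (negPf Ia) mulr0n !mul0r.
Qed.

(** Dual form of the first fundamental theorem: an invariant tensor that is
    orthogonal to all products of Kronecker deltas is zero. *)
Theorem orthogonal_fft t : invariant t ->
  (forall kap, perfect finset.setT kap -> \sum_I t (relabel I kap) = 0) ->
  forall I, t I = 0.
Proof.
move=> inv null; apply: (@perfect_contractions_eq0 _ _ _ finset.setT).
- by move=> I J eqIJ; congr t; apply/ffunP => s; apply: eqIJ; rewrite inE.
- by move=> i j I; apply: invariant_elem.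
- by move=> I x; apply: invariant_even.
- by move=> kap _; apply: null.
Qed.

End Orthogonal.

(** * Closed chains of skew matrices *)

Section TraceWords.
Variables (R : realType) (m : nat) (V : finType) (L : eqType).
Implicit Types (M : L -> 'M[R]_m) (w : seq L) (x : {ffun V -> 'I_m}).
Local Notation edge := (seq L * (V * V))%type.
Implicit Types (e : edge) (es : seq edge).

Definition word_mx M w := \big[mulmx/1%:M]_(k <- w) M k.

Definition skew M := forall k, (M k)^T = - M k.

Definition edge_ends es := flatten [seq [:: e.2.1; e.2.2] | e <- es].

(** An edge (w, (u, v)) carries the matrix that is the product along the word w;
    its entry is taken at the indices of its two end points. *)
Definition edge_val M e x := word_mx M e.1 (x e.2.1) (x e.2.2).

Lemma word_mx_cons M k w : word_mx M (k :: w) = M k *m word_mx M w.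
Proof. by rewrite /word_mx big_cons. Qed.

Lemma word_mx_cat M w w' : word_mx M (w ++ w') = word_mx M w *m word_mx M w'.
Proof.
elim: w => [|k w IHw]; first by rewrite /word_mx big_nil mul1mx.
by rewrite cat_cons !word_mx_cons IHw mulmxA.
Qed.

Lemma word_mx_tr M w :
  skew M -> (word_mx M w)^T = (-1) ^+ size w *: word_mx M (rev w).
Proof.
move=> skewM; elim: w => [|k w IHw].
  by rewrite /word_mx !big_nil trmx1 expr0 scale1r.
rewrite word_mx_cons trmx_mul IHw skewM mulmxN rev_cons -cats1 word_mx_cat.
rewrite word_mx_cons {3}/word_mx big_nil mulmx1.
by rewrite exprS mulN1r scaleNr -scalemxAl.
Qed.

Lemma edge_val_upd M e x v y : v \notin [:: e.2.1; e.2.2] ->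
  edge_val M e (upd x v y) = edge_val M e x.
Proof.
rewrite !inE negb_or /edge_val !updE ![_ == v]eq_sym.
by case/andP => /negPf-> /negPf->.
Qed.

Lemma edges_upd M es x v y : v \notin edge_ends es ->
  \prod_(e <- es) edge_val M e (upd x v y) = \prod_(e <- es) edge_val M e x.
Proof.
elim: es => [|e es IHes]; first by rewrite !big_nil.
rewrite !big_cons /edge_ends /= !inE !negb_or => /and3P[v1 v2 ves].
by rewrite IHes // edge_val_upd // !inE negb_or v1.
Qed.

(** The index of one vertex is summed first; for m = 0 both sides vanish since
    the vertex v has no index. *)
Lemma sum_ffun_avg (v : V) (c : R) (h h' : {ffun V -> 'I_m} -> R) :
  (forall x, \sum_y h (upd x v y) = c * h' x) ->
  \sum_x h x = m%:R^-1 * (c * \sum_x h' x).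
Proof.
move=> avg; have := sum_upd v h; under eq_bigr do rewrite avg.
rewrite -mulr_sumr => ->; have [m0|m_gt0] := posnP m; last first.
  by rewrite mulKf // pnatr_eq0 gtn_eqF.
by rewrite big1 ?mulr0 // => x; case: (x v) => i; rewrite m0.
Qed.

(** When every vertex has degree 0 or 2, the edges form cycles. Induction on the
    number of edges: a loop contributes a trace; otherwise the first edge (u, v)
    meets a second edge at v, and summing over the index of v merges the two
    into one edge carrying the product matrix. If the second edge ends at v, it
    is transposed first, which reverses its word up to a sign because the
    matrices are skew. A vertex of degree 0 contributes a factor m, which c
    absorbs. *)
Lemma closed_edges_traces es :
  all (fun e => e.1 != [::]) es ->
  (forall v, count_mem v (edge_ends es) \in [:: 0; 2]%N) ->
  exists (c : R) (ws : seq (seq L)),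
    [/\ perm_eq (flatten ws) (flatten [seq e.1 | e <- es]), [::] \notin ws &
     forall M, skew M -> \sum_x \prod_(e <- es) edge_val M e x
       = c * \prod_(w <- ws) \tr (word_mx M w)].
Proof.
have [k] := ubnP (size es); elim: k es => // k IHk [|[w [u v]] es] /=.
  move=> _ _ _; exists (#|{ffun V -> 'I_m}|%:R), [::]; split=> // M _.
  by under eq_bigr do rewrite big_nil; rewrite sumr_const big_nil mulr1.
rewrite ltnS => size_es /andP[w_n0 es_n0] ends.
have {}ends t :
    ((u == t) + (v == t) + count_mem t (edge_ends es))%N \in [:: 0; 2]%N.
  by rewrite -addnA; apply: ends.
have [uv|uv] := eqVneq u v.
  have ves : v \notin edge_ends es.
    apply/negP; rewrite -has_pred1 has_count; have := ends v;
      rewrite uv eqxx !inE.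
    by case: count.
  have [t|c [ws [perm_ws ws_n0 sumE]]] := IHk es size_es es_n0.
    have := ends t; rewrite uv; case: eqP => // <- _.
    by rewrite (count_memPn ves).
  exists (m%:R^-1 * c), (w :: ws); split=> [||M skewM] //=.
  - by rewrite perm_cat2l.
  - by rewrite inE negb_or eq_sym w_n0.
  rewrite (@sum_ffun_avg v (\tr (word_mx M w)) _
             (fun x => \prod_(e <- es) edge_val M e x)) => [|x].
    by rewrite sumE // big_cons; ring.
  rewrite /mxtrace mulr_suml; apply: eq_bigr => y _.
  by rewrite big_cons edges_upd // {1}/edge_val /= uv updE eqxx.
have cnt1 : count_mem v (edge_ends es) = 1%N.
  by have := ends v; rewrite eqxx (negPf uv) !inE; case: count => [|[|]].
have [e0 e0es ve0] : exists2 e, e \in es & v \in [:: e.2.1; e.2.2].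
  have : v \in edge_ends es by rewrite -has_pred1 has_count cnt1.
  by case/flatten_mapP => e ees ve; exists e.
have perm_es := perm_to_rem e0es; set es' := rem e0 es in perm_es.
(* Orient the second edge so that it starts at v. *)
have [w' [b [sgn [w'_n0 perm_w' cnt_e0 e0E]]]] :
    exists w' b (sgn : R), [/\ w' != [::], perm_eq w' e0.1,
      (forall t, count_mem t [:: e0.2.1; e0.2.2] = (v == t) + (b == t))%N &
      forall M x, skew M ->
        edge_val M e0 x = sgn * edge_val M (w', (v, b)) x].
  have e0_n0 : e0.1 != [::] := allP es_n0 _ e0es.
  case: e0 ve0 e0_n0 {e0es perm_es es'} => [w0 [a b]] /=; rewrite !inE.
  case/orP=> /eqP-> w0_n0.
    exists w0, b, 1; split=> // [t|M x _]; last by rewrite mul1r.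
    by rewrite addn0.
  exists (rev w0), a, ((-1) ^+ size w0); split=> [|||M x skewM] //.
  - by rewrite -size_eq0 size_rev size_eq0.
  - by rewrite perm_rev.
  - by move=> t; rewrite addn0 addnC.
  by rewrite /edge_val /= -[word_mx M w0]trmxK word_mx_tr // !mxE.
have cnt_es t : count_mem t (edge_ends es)
    = ((v == t) + (b == t) + count_mem t (edge_ends es'))%N.
  rewrite -cnt_e0 -count_cat.
  by have /permP-> : perm_eq (edge_ends es) (edge_ends (e0 :: es'))
    by apply/perm_flatten/perm_map.
have [bv ves'] : b != v /\ v \notin edge_ends es'.
  move: cnt1; rewrite cnt_es eqxx; case: eqVneq => //= _.
  by rewrite addn0 => -[/eqP]; rewrite -leqn0 leqNgt -has_count has_pred1.
have [|||c [ws [perm_ws ws_n0 sumE]]] := IHk ((w ++ w', (u, b)) :: es').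
- by apply: leq_trans size_es; rewrite /= ltnS (perm_size perm_es).
- rewrite /= -size_eq0 size_cat addn_eq0 !size_eq0 negb_and w_n0 /=.
  by apply/allP => e /mem_rem; apply: (allP es_n0).
- move=> t; have -> : count_mem t (edge_ends ((w ++ w', (u, b)) :: es'))
      = ((u == t) + (b == t) + count_mem t (edge_ends es'))%N.
    by rewrite /edge_ends /= addnA.
  have := ends t; rewrite cnt_es; case: (eqVneq v t) => [<- _|_];
    last by rewrite addn0 add0n addnA.
  by rewrite (negPf uv) (negPf bv) (count_memPn ves').
exists (m%:R^-1 * (sgn * c)), ws; split=> // [|M skewM].
  apply: perm_trans perm_ws _; rewrite /= -catA perm_cat2l.
  apply: (@perm_trans _ (e0.1 ++ flatten [seq e.1 | e <- es'])).
    by rewrite perm_cat2r.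
  rewrite perm_sym; apply: (perm_flatten (perm_map _ perm_es)).
rewrite (@sum_ffun_avg v sgn _ (fun x =>
   \prod_(e <- (w ++ w', (u, b)) :: es') edge_val M e x)) => [|x].
  by rewrite sumE // !mulrA.
rewrite [in RHS]big_cons [in RHS]/edge_val /= word_mx_cat mxE.
rewrite mulr_suml mulr_sumr.
apply: eq_bigr => y _; rewrite big_cons (perm_big _ perm_es) big_cons /=.
rewrite edges_upd // e0E // /edge_val /= !updE eqxx (negPf uv) (negPf bv).
by rewrite -!mulrA [in RHS]mulrCA.
Qed.

End TraceWords.

(** * Complete contractions are trace invariants *)

Section Pairings.
Variables (R : realType) (m r d q : nat).
Hypothesis dq : d = (2 * q)%N.
Implicit Types (j : {linear 'cV[R]_r -> 'M[R]_m}).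
Implicit Types (I : {ffun 'I_d * bool -> 'I_m}) (K : {ffun 'I_d -> 'I_r}).

(** The entries of the d-th tensor power of j: the e-th factor has its two
    indices in v in the slots (e, false) and (e, true), and its index in z in
    slot e. *)
Definition jtensor j I K : R :=
  \prod_e j (delta_mx (K e) 0) (I (e, false)) (I (e, true)).

Lemma orthonormal_complete (Z : 'I_r -> 'cV[R]_r) b c : orthonormal Z ->
  \sum_a Z a b 0 * Z a c 0 = (b == c)%:R.
Proof.
move=> onZ; pose U : 'M[R]_r := \matrix_(a, x) Z a x 0.
have : U *m U^T = 1%:M.
  apply/matrixP => a a'; rewrite !mxE -onZ; apply: eq_bigr => x _.
  by rewrite !mxE.
move/mulmx1C/matrixP/(_ b c); rewrite !mxE => <-.
by apply: eq_bigr => a _; rewrite !mxE.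
Qed.

Definition linear_form (f : 'cV[R]_r -> R) :=
  forall z, f z = \sum_b z b 0 * f (delta_mx b 0).

Lemma linear_form_entry j x y : linear_form (fun z => j z x y).
Proof.
move=> z; rewrite {1}(matrix_sum_delta z) linear_sum summxE.
by apply: eq_bigr => b _; rewrite big_ord1 linearZ mxE.
Qed.

Lemma orthonormal_trace (Z : 'I_r -> 'cV[R]_r) (f g : 'cV[R]_r -> R) :
  linear_form f -> linear_form g -> orthonormal Z ->
  \sum_a f (Z a) * g (Z a) = \sum_a f (delta_mx a 0) * g (delta_mx a 0).
Proof.
move=> linf ling onZ.
transitivity (\sum_b \sum_c (\sum_a Z a b 0 * Z a c 0) *
                (f (delta_mx b 0) * g (delta_mx c 0))).
  under eq_bigr do rewrite linf ling mulr_suml.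
  rewrite exchange_big; apply: eq_bigr => b _.
  under eq_bigr do rewrite mulr_sumr.
  rewrite exchange_big; apply: eq_bigr => c _.
  by rewrite mulr_suml; apply: eq_bigr => a _; rewrite mulrACA.
apply: eq_bigr => b _; rewrite (bigD1 b) //= [X in _ + X]big1 => [|c neq].
  by rewrite orthonormal_complete // eqxx mul1r addr0.
by rewrite orthonormal_complete // eq_sym (negPf neq) mul0r.
Qed.

(** Each label occurs in exactly two factors, so that the sum is a product over
    the labels of traces of bilinear forms on z. *)
Lemma sum_basis_indep (lab : 'I_d -> 'I_q) (Z : 'I_r -> 'cV[R]_r)
    (f : 'I_d -> 'cV[R]_r -> R) :
  (forall e, linear_form (f e)) ->
  (forall k, #|[set e | lab e == k]| = 2%N) -> orthonormal Z ->
  \sum_(alpha : {ffun 'I_q -> 'I_r}) \prod_e f e (Z (alpha (lab e)))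
  = \sum_(alpha : {ffun 'I_q -> 'I_r})
      \prod_e f e (delta_mx (alpha (lab e)) 0).
Proof.
move=> linf lab2 onZ.
have distr (z : 'I_r -> 'cV[R]_r) :
    \sum_(alpha : {ffun 'I_q -> 'I_r}) \prod_e f e (z (alpha (lab e)))
    = \prod_k \sum_a \prod_(e | lab e == k) f e (z a).
  rewrite bigA_distr_bigA; apply: eq_bigr => alpha _.
  rewrite (partition_big lab predT) //=; apply: eq_bigr => k _.
  by apply: eq_bigr => e /eqP->.
rewrite distr (distr (fun a => delta_mx a 0)); apply: eq_bigr => k _.
have /eqP/cards2P[e1 [e2 [ne12 fib]]] := lab2 k.
have pair (z : 'I_r -> 'cV[R]_r) a :
    \prod_(e | lab e == k) f e (z a) = f e1 (z a) * f e2 (z a).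
  rewrite (eq_bigl (fun e => e \in [set e1; e2])) => [|e].
    by rewrite big_setU1 ?inE //= big_set1.
  by rewrite -fib inE.
under eq_bigr do rewrite pair.
rewrite orthonormal_trace //; apply: eq_bigr => a _.
exact/esym/(pair (fun a => delta_mx a 0)).
Qed.

(** A perfect pairing of d = 2q slots has q pairs; numbering them turns the map
    kap into a labelling of the slots by 'I_q. *)
Lemma perfect_labels (kap : 'I_d -> 'I_d) : perfect finset.setT kap ->
  exists (lab : 'I_d -> 'I_q) (emb : 'I_q -> 'I_d),
    [/\ injective emb, forall e, kap e = emb (lab e) &
        forall k, #|[set e | lab e == k]| = 2%N].
Proof.
move=> perf; pose B := kap @: finset.setT.
have fib b : b \in B -> #|[set s in finset.setT | kap s == b]| = 2%N.
  case/imsetP => s _ ->; have := perf (kap s); rewrite !inE.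
  by case/orP=> /eqP // /cards0_eq/setP/(_ s); rewrite !inE eqxx.
have cardB : q = #|B|.
  have : (d = \sum_(b in B) 2)%N.
    rewrite -{1}(card_ord d) -cardsT -sum1_card.
    rewrite (partition_big kap (mem B)) => [|s _]; last exact: imset_f.
    apply: eq_bigr => b bB; rewrite -(fib b bB) -sum1_card.
    by apply: eq_bigl => s; rewrite !inE.
  rewrite sum_nat_const => dB; apply/eqP.
  by rewrite -(eqn_pmul2l (isT : 0 < 2)%N) -dq {1}dB mulnC.
pose rnk e := enum_rank_in (imset_f kap (finset.in_setT e)) (kap e).
have rnkK e : enum_val (rnk e) = kap e.
  by rewrite enum_rankK_in // imset_f.
exists (fun e => cast_ord (esym cardB) (rnk e)).
exists (fun k => enum_val (cast_ord cardB k)).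
split=> [k k' /enum_val_inj/cast_ord_inj//|e|k].
  by rewrite cast_ordKV rnkK.
rewrite -(fib (enum_val (cast_ord cardB k))) ?enum_valP //.
apply: eq_card => e; rewrite !inE /= -rnkK (inj_eq enum_val_inj).
by rewrite -(inj_eq (@cast_ord_inj _ _ cardB)) cast_ordKV.
Qed.

(** Every alpha has the same number of extensions x along emb, namely one factor
    n for each slot off the image of emb. *)
Lemma sum_relabel_emb n (emb : 'I_q -> 'I_d) : injective emb ->
  exists c : R, forall h : {ffun 'I_q -> 'I_n} -> R,
    \sum_(x : {ffun 'I_d -> 'I_n}) h [ffun k => x (emb k)]
    = c * \sum_alpha h alpha.
Proof.
move=> emb_inj.
pose free (e : 'I_d) := (if e \in codom emb then 1 else n)%N.
exists (foldr muln 1%N [seq free e | e : 'I_d])%:R => h.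
rewrite (partition_big (fun x : {ffun 'I_d -> 'I_n} => [ffun k => x (emb k)])
  predT) //= mulr_sumr; apply: eq_bigr => alpha _.
under eq_bigr => x /eqP-> do [].
pose F (e : 'I_d) : pred 'I_n :=
  [pred y | [forall k, (emb k == e) ==> (alpha k == y)]].
rewrite (eq_bigl (fun x => x \in family F)) => [|x].
  rewrite sumr_const mulr_natl; congr (_ *+ _).
  rewrite card_family; congr foldr; apply: eq_map => e.
  rewrite /free; case: ifP => [/codomP[k ->]|Ne].
    rewrite -(card1 (alpha k)); apply: eq_card => y; rewrite !inE.
    apply/forallP/idP => [/(_ k)|/eqP-> k']; first by rewrite eqxx eq_sym.
    by rewrite (inj_eq emb_inj); case: eqP => [->|//]; rewrite eqxx.
  rewrite -[RHS](card_ord n); apply: eq_card => y; rewrite !inE.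
  apply/forallP => k; apply/implyP => /eqP ke.
  by rewrite -ke codom_f in Ne.
apply/eqP/familyP => [eqa e|fam].
  by rewrite inE; apply/forallP => k; apply/implyP => /eqP<-;
    rewrite -eqa ffunE.
apply/ffunP => k; rewrite ffunE; have := fam (emb k).
by rewrite inE => /forallP/(_ k); rewrite eqxx => /eqP.
Qed.

Lemma card_bool_pairs (T : finType) (Q : pred (T * bool)) :
  #|[set s | Q s]| = (\sum_e (Q (e, false) + Q (e, true)))%N.
Proof.
transitivity (\sum_e \sum_b Q (e, b))%N.
  rewrite pair_bigA -sum1_card big_mkcond; apply: eq_bigr => -[e b] _ /=.
  by rewrite inE; case: (Q _).
by apply: eq_bigr => e _; rewrite big_bool addnC.
Qed.

(** The pairing of the slots in z labels the 2q copies of j, each label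
    occurring twice; the pairing of the slots in v links the copies into cycles,
    each of which contributes the trace of a word in the labels. *)
Lemma pairing_trace_inv (kapV : 'I_d * bool -> 'I_d * bool)
    (kapU : 'I_d -> 'I_d) :
  perfect finset.setT kapV -> perfect finset.setT kapU ->
  exists (c : R) (w : seq (seq 'I_q)), admissible w /\
    forall j, so_valued j -> forall Z, orthonormal Z ->
      \sum_K \sum_I jtensor j (relabel I kapV) (relabel K kapU)
      = c * trace_inv j Z w.
Proof.
move=> perfV /perfect_labels[lab [emb [emb_inj labE lab2]]].
have [c' sumE] := @sum_relabel_emb r emb emb_inj.
pose es := [seq ([:: lab e], (kapV (e, false), kapV (e, true)))
            | e <- enum 'I_d].
have [| |c [w [perm_w w_n0 trE]]] := @closed_edges_traces R m _ _ es.
- by apply/allP => e /mapP[? _ ->].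
- move=> v; suff -> : count_mem v (edge_ends es)
    = #|[set s in finset.setT | kapV s == v]| by apply: perfV.
  have -> : edge_ends es = [seq kapV s | s <- flatten
      [seq [:: (e, false); (e, true)] | e <- enum 'I_d]].
    rewrite /edge_ends map_flatten -!map_comp; congr flatten.
  rewrite count_map count_flatten sumnE !big_map -enumT big_enum /=.
  rewrite card_bool_pairs; apply: eq_bigr => e _.
  by rewrite /= !inE addn0.
exists (c' * c), w; split.
  rewrite /admissible w_n0 andbT; apply: perm_trans perm_w _.
  have -> : flatten [seq e.1 | e <- es] = [seq lab e | e <- enum 'I_d].
    by rewrite /es -map_comp; elim: (enum _) => //= a s ->.
  apply/allP => x _; apply/eqP; rewrite /= count_map count_flatten sumnE.
  transitivity #|[set e | lab e == x]|.
    rewrite -sum1_count big_enum_cond -sum1_card; apply: eq_bigl => e.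
    by rewrite !inE.
  rewrite lab2 !big_map -enumT big_enum (bigD1 x) //= eqxx.
  by rewrite big1 // => y /negPf->.
move=> j soj Z onZ; have skewj alpha : skew (fun k => j (Z (alpha k))).
  by move=> k; apply: soj.
pose F (x : {ffun 'I_d * bool -> 'I_m}) e z : R :=
  j z (x (kapV (e, false))) (x (kapV (e, true))).
have valE z x : \prod_(e <- es) edge_val (fun k => j (z k)) e x
    = \prod_e F x e (z (lab e)).
  rewrite big_map big_enum; apply: eq_bigr => e _.
  by rewrite /edge_val /= word_mx_cons /word_mx big_nil mulmx1.
transitivity (c' * \sum_(alpha : {ffun 'I_q -> 'I_r}) \sum_x
    \prod_e F x e (delta_mx (alpha (lab e)) 0)).
  rewrite -sumE; apply: eq_bigr => K _; apply: eq_bigr => I _.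
  by apply: eq_bigr => e _; rewrite /F !ffunE labE.
rewrite -mulrA; congr (_ * _); rewrite exchange_big /=.
have indep x : _ = \sum_(alpha : {ffun 'I_q -> 'I_r})
    \prod_e F x e (delta_mx (alpha (lab e)) 0) :=
  sum_basis_indep (fun e => linear_form_entry j _ _) lab2 onZ.
under eq_bigr do rewrite -indep.
rewrite exchange_big mulr_sumr; apply: eq_bigr => alpha _ /=.
by rewrite -trE //; apply: eq_bigr => x _; rewrite valE.
Qed.

End Pairings.

(** * Orthogonal decomposition of functions on a finite set *)

(** W is the row space of a matrix A: take A of maximal rank among the matrices
    with rows in W. The projection onto W is then given by a Gram matrix. *)
Lemma orthogonal_decomposition (R : realType) (T : finType)
    (W : (T -> R) -> Prop) :
  W (fun=> 0) -> (forall c f g, W f -> W g -> W (fun x => c * f x + g x)) ->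
  forall t, exists s, W s /\ forall w, W w -> \sum_x (t x - s x) * w x = 0.
Proof.
move=> W0 Wlin t; set N := #|T|.
pose of_row (v : 'rV[R]_N) (x : T) := v 0 (enum_rank x).
pose to_row (f : T -> R) : 'rV[R]_N := \row_i f (enum_val i).
have to_rowK f : of_row (to_row f) = f.
  by apply/funext => x; rewrite /of_row mxE enum_rankK.
pose inW (A : 'M[R]_N) := forall u : 'rV_N, W (of_row (u *m A)).
pose Q k := `[< exists A : 'M[R]_N, inW A /\ \rank A = k >].
have Q0 : exists k, Q k.
  exists 0%N; apply/asboolP; exists 0; split; last exact: mxrank0.
  move=> u; rewrite mulmx0; suff -> : of_row 0 = fun=> 0 by [].
  by apply/funext => x; rewrite /of_row mxE.
have Qle k : Q k -> (k <= N)%N.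
  by move=> /asboolP[A [_ <-]]; apply: rank_leq_row.
case: (ex_maxnP Q0 Qle) => k /asboolP[A [AW rkA]] kmax.
have subA w : W w -> (to_row w <= A)%MS.
  move=> Ww; pose B := (A + to_row w)%MS.
  have rkB : (\rank B <= \rank A)%N.
    rewrite rkA; apply: kmax; apply/asboolP; exists B; split=> // u.
    have /sub_addsmxP[[u1 u2] /= ->] := submxMl u B.
    have -> : of_row (u1 *m A + u2 *m to_row w)
        = fun x => u2 0 0 * w x + of_row (u1 *m A) x.
      apply/funext => x; rewrite -{2}(to_rowK w) /of_row [LHS]mxE addrC.
      by congr (_ + _); rewrite !mxE big_ord1 !mxE.
    exact: Wlin.
  have [rkle rkE] := mxrank_leqif_sup (addsmxSl A (to_row w)).
  have BA : (B <= A)%MS by rewrite -rkE eqn_leq rkle.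
  exact: submx_trans (addsmxSr A _) BA.
pose C := row_base A; pose G := C *m C^T.
have dot_ge0 (v : 'rV[R]_N) : v *m v^T = 0 -> v = 0.
  move/matrixP/(_ 0 0); rewrite !mxE => /eqP;
    rewrite psumr_eq0 => [/allP v0|i _].
    apply/rowP => i; rewrite mxE; have := v0 i; rewrite mem_index_enum mxE.
    by rewrite mulf_eq0 orbb => /(_ isT)/eqP.
  by rewrite mxE -expr2 sqr_ge0.
have Gunit : G \in unitmx.
  rewrite -row_free_unit; apply: inj_row_free => v vG0.
  have /eqP : v *m C = 0.
    by apply: dot_ge0; rewrite trmx_mul mulmxA -(mulmxA v) vG0 mul0mx.
  by rewrite mulmx_free_eq0 ?row_base_free // => /eqP.
pose s := to_row t *m C^T *m invmx G *m C.
exists (of_row s); split.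
  have /submxP[D ->] : (s <= A)%MS by rewrite -(eq_row_base A) submxMl.
  exact: AW.
move=> w Ww; have /submxP[D wE] : (to_row w <= C)%MS.
  by rewrite (eq_row_base A) subA.
have orth : (to_row t - s) *m (to_row w)^T = 0.
  rewrite wE trmx_mul mulmxA mulmxBl /s.
  by rewrite -(mulmxA _ C C^T) mulmxKV // subrr mul0mx.
clearbody s; move/matrixP/(_ 0 0): orth; rewrite !mxE => orth;
  rewrite -[RHS]orth.
rewrite (reindex (fun i : 'I_N => enum_val i)) /=; last first.
  by exists enum_rank => x _; [apply: enum_valK|apply: enum_rankK].
by apply: eq_bigr => i _; rewrite !mxE /of_row enum_valK.
Qed.

(** * Invariant polynomials in the bracket *)

Section InvariantForms.
Variables (R : realType) (m r d : nat).
Implicit Types (j : {linear 'cV[R]_r -> 'M[R]_m}).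
Implicit Types (I : {ffun 'I_d * bool -> 'I_m}) (K : {ffun 'I_d -> 'I_r}).
Local Notation slots :=
  ({ffun 'I_d * bool -> 'I_m} * {ffun 'I_d -> 'I_r})%type.
Implicit Types (t : slots -> R).

(** For orthogonal A and B, the actions of O(m) and O(r) on the maps j. *)
Definition twistV (A : 'M[R]_m) j z := A *m j z *m A^T.
Definition twistU (B : 'M[R]_r) j z := j (B^T *m z).

Fact twistV_linear A j : linear (twistV A j).
Proof.
by move=> c y z; rewrite /twistV linearP mulmxDr mulmxDl -scalemxAr -scalemxAl.
Qed.
HB.instance Definition _ A j :=
  GRing.isLinear.Build R 'cV[R]_r 'M[R]_m *:%R (twistV A j) (twistV_linear A j).

Fact twistU_linear B j : linear (twistU B j).
Proof. by move=> c y z; rewrite /twistU mulmxDr -scalemxAr linearP. Qed.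
HB.instance Definition _ B j :=
  GRing.isLinear.Build R 'cV[R]_r 'M[R]_m *:%R (twistU B j) (twistU_linear B j).

Lemma twistV_so A j : so_valued j -> so_valued (twistV A j).
Proof.
by move=> soj z; rewrite /= /twistV !trmx_mul trmxK soj mulNmx mulmxN mulmxA.
Qed.

Lemma twistU_so B j : so_valued j -> so_valued (twistU B j).
Proof. by move=> soj z; apply: soj. Qed.

Lemma jtensor_twistU B j I K :
  jtensor (twistU B j) I K = act B (jtensor j I) K.
Proof.
rewrite /jtensor /act /= /twistU.
under [RHS]eq_bigr do rewrite -big_split /=.
rewrite -(bigA_distr_bigA (fun e k =>
  B (K e) k * j (delta_mx k 0) (I (e, false)) (I (e, true)))).
apply: eq_bigr => e _; rewrite linear_form_entry; apply: eq_bigr => k _.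
rewrite !mxE (bigD1 (K e)) //= !mxE !eqxx mulr1 big1 ?addr0 // => i /negPf ne.
by rewrite !mxE ne andFb mulr0.
Qed.

Lemma jtensor_twistV A j I K :
  jtensor (twistV A j) I K = act A (fun I' => jtensor j I' K) I.
Proof.
(* A pair of indices for each factor is the same as an index for each of the
   2d slots in v. *)
pose curry (P : {ffun 'I_d -> 'I_m * 'I_m}) : {ffun 'I_d * bool -> 'I_m} :=
  [ffun s => if s.2 then (P s.1).2 else (P s.1).1].
pose uncurry I' : {ffun 'I_d -> 'I_m * 'I_m} :=
  [ffun e => (I' (e, false), I' (e, true))].
have curryK : cancel curry uncurry.
  by move=> P; apply/ffunP => e; rewrite !ffunE /=; case: (P e).
have uncurryK : cancel uncurry curry.
  by move=> I'; apply/ffunP => -[e []]; rewrite !ffunE.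
rewrite /act (reindex curry) /=; last by exists uncurry => ? _.
transitivity (\sum_(P : {ffun 'I_d -> 'I_m * 'I_m}) \prod_e
   (A (I (e, false)) (P e).1 * A (I (e, true)) (P e).2
    * j (delta_mx (K e) 0) (P e).1 (P e).2)); last first.
  apply: eq_bigr => P _; rewrite /jtensor.
  rewrite (eq_bigr (fun s => if s.2 then A (I (s.1, true)) (P s.1).2
     else A (I (s.1, false)) (P s.1).1)) => [|[e []] _]; rewrite ?ffunE //.
  rewrite -(pair_bigA _ (fun e (b : bool) => if b then A (I (e, true)) (P e).2
     else A (I (e, false)) (P e).1)) -big_split /=.
  apply: eq_bigr => e _; rewrite big_bool !ffunE /=.
  by rewrite [A _ _ * _]mulrC.
rewrite -(bigA_distr_bigA (fun e p =>
  A (I (e, false)) p.1 * A (I (e, true)) p.2 * j (delta_mx (K e) 0) p.1 p.2)).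
apply: eq_bigr => e _; rewrite /= /twistV !mxE.
rewrite -(pair_bigA _ (fun x y => A (I (e, false)) x * A (I (e, true)) y
  * j (delta_mx (K e) 0) x y)) /= exchange_big; apply: eq_bigr => y _ /=.
rewrite !mxE mulr_suml; apply: eq_bigr => x _; ring.
Qed.

(** Homogeneous polynomials of degree d in the entries of j; t is a tensor of
    coefficients, which the polynomial does not determine. *)
Definition form_of t j := \sum_(p : slots) t p * jtensor j p.1 p.2.

Definition actV A t : slots -> R := fun p => act A (fun I => t (I, p.2)) p.1.
Definition actU B t : slots -> R := fun p => act B (fun K => t (p.1, K)) p.2.

Lemma act_adjoint n (S : finType) (g : 'M[R]_n) (t u : {ffun S -> 'I_n} -> R) :
  \sum_I act g t I * u I = \sum_I t I * act g^T u I.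
Proof.
rewrite /act; under eq_bigr do rewrite mulr_suml.
rewrite exchange_big; apply: eq_bigr => J _ /=; rewrite mulr_sumr.
apply: eq_bigr => I _; rewrite mulrAC mulrC; congr (_ * (_ * _)).
by apply: eq_bigr => s _; rewrite mxE.
Qed.

Lemma actV_adjoint A t u : \sum_p actV A t p * u p = \sum_p t p * actV A^T u p.
Proof.
have split (F : slots -> R) : \sum_p F p = \sum_K \sum_I F (I, K).
  by rewrite exchange_big pair_bigA; apply: eq_bigr => -[].
rewrite !split; apply: eq_bigr => K _.
exact: (act_adjoint A (fun I => t (I, K)) (fun I => u (I, K))).
Qed.

Lemma actU_adjoint B t u : \sum_p actU B t p * u p = \sum_p t p * actU B^T u p.
Proof.
have split (F : slots -> R) : \sum_p F p = \sum_I \sum_K F (I, K).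
  by rewrite pair_bigA; apply: eq_bigr => -[].
rewrite !split; apply: eq_bigr => I _.
exact: (act_adjoint B (fun K => t (I, K)) (fun K => u (I, K))).
Qed.

Lemma form_of_actV A t j : form_of (actV A t) j = form_of t (twistV A^T j).
Proof.
rewrite /form_of actV_adjoint; apply: eq_bigr => p _.
by rewrite jtensor_twistV.
Qed.

Lemma form_of_actU B t j : form_of (actU B t) j = form_of t (twistU B^T j).
Proof.
rewrite /form_of actU_adjoint; apply: eq_bigr => p _.
by rewrite jtensor_twistU.
Qed.

(** Membership in the space of coefficient tensors whose polynomial is a
    combination of the trace invariants; tensors of the zero polynomial belong
    to it. *)
Definition trace_expressible q t := exists cs : seq (R * seq (seq 'I_q)),
  all (fun cw => admissible cw.2) cs /\
  forall j, so_valued j -> forall Z, orthonormal Z ->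
    form_of t j = \sum_(cw <- cs) cw.1 * trace_inv j Z cw.2.

Lemma form_of_lin c t u j :
  form_of (fun p => c * t p + u p) j = c * form_of t j + form_of u j.
Proof.
rewrite /form_of mulr_sumr -big_split; apply: eq_bigr => p _.
by rewrite mulrDl mulrA.
Qed.

Lemma trace_expressible0 q t :
  (forall j, so_valued j -> form_of t j = 0) -> trace_expressible q t.
Proof. by move=> t0; exists [::]; split=> // j soj Z _; rewrite big_nil t0. Qed.

Lemma trace_expressible_lin q c t u :
  trace_expressible q t -> trace_expressible q u ->
  trace_expressible q (fun p => c * t p + u p).
Proof.
move=> [cs [adm_cs csE]] [ds [adm_ds dsE]].
exists ([seq (c * cw.1, cw.2) | cw <- cs] ++ ds); split.
  by rewrite all_cat adm_ds andbT all_map.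
move=> j soj Z onZ; rewrite form_of_lin (csE _ soj _ onZ) (dsE _ soj _ onZ).
rewrite big_cat big_map mulr_sumr; congr (_ + _); apply: eq_bigr => cw _.
by rewrite mulrA.
Qed.

Lemma mx_prod_conj (A : 'M[R]_m) (T : Type) (s : seq T) (M : T -> 'M[R]_m) :
  A^T *m A = 1%:M -> \tr (\big[mulmx/1%:M]_(k <- s) (A *m M k *m A^T))
  = \tr (\big[mulmx/1%:M]_(k <- s) M k).
Proof.
move=> orthA.
have -> : \big[mulmx/1%:M]_(k <- s) (A *m M k *m A^T)
    = A *m (\big[mulmx/1%:M]_(k <- s) M k) *m A^T.
  elim: s => [|k s IHs]; first by rewrite !big_nil mulmx1 (mulmx1C orthA).
  by rewrite !big_cons IHs !mulmxA -(mulmxA _ A^T A) orthA mulmx1.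
by rewrite mxtrace_mulC mulmxA orthA mul1mx.
Qed.

Lemma trace_inv_twistV q A j Z (w : seq (seq 'I_q)) :
  orthogonal_mx A -> trace_inv (twistV A j) Z w = trace_inv j Z w.
Proof.
move=> orthA; apply: eq_bigr => alpha _; apply: eq_bigr => s _.
exact: (mx_prod_conj s (fun k => j (Z (alpha k)))).
Qed.

Lemma orthonormal_mul (B : 'M[R]_r) (Z : 'I_r -> 'cV[R]_r) :
  orthogonal_mx B -> orthonormal Z -> orthonormal (fun a => B *m Z a).
Proof. by move=> orthB onZ a b; rewrite dot_mull mulmxA orthB mul1mx. Qed.

Lemma orthogonal_tr k (g : 'M[R]_k) : orthogonal_mx g -> orthogonal_mx g^T.
Proof. by rewrite /orthogonal_mx trmxK => /mulmx1C. Qed.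

Lemma orthonormal_std : orthonormal (fun a : 'I_r => delta_mx a 0 : 'cV[R]_r).
Proof.
move=> a b; rewrite /dot (bigD1 a) //= big1 => [|i /negPf ne].
  by rewrite !mxE !eqxx !andbT mul1r addr0.
by rewrite !mxE ne mul0r.
Qed.

(** Write t = s + u with s expressible and u orthogonal to all expressible
    tensors. For an orthogonal matrix g, the polynomial of g u - u is zero, as
    the polynomials of t and of s are invariant; so g u - u is expressible, and
    since the adjoint of g preserves zero polynomials, it is also orthogonal to
    itself. Hence u is an invariant tensor, and being orthogonal to the complete
    contractions it vanishes by the first fundamental theorem, applied first to
    the slots in v and then to those in z. *)
Theorem invariant_form_expressible q t : d = (2 * q)%N ->
  (forall A j, orthogonal_mx A -> so_valued j ->
     form_of t (twistV A j) = form_of t j) ->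
  (forall B j, orthogonal_mx B -> so_valued j ->
     form_of t (twistU B j) = form_of t j) ->
  trace_expressible q t.
Proof.
move=> dq invV invU.
have [||s [Ws orth]] :=
    @orthogonal_decomposition R slots (trace_expressible q) _ _ t.
- by apply: trace_expressible0 => j _; apply: big1 => p _; rewrite mul0r.
- by move=> c f g; apply: trace_expressible_lin.
pose u p := t p - s p.
have uE j : form_of u j = form_of t j - form_of s j.
  by rewrite /form_of -sumrB; apply: eq_bigr => p _; rewrite mulrBl.
have uinvV A j : orthogonal_mx A -> so_valued j ->
    form_of u (twistV A j) = form_of u j.
  move=> orthA soj; rewrite !uE invV //; congr (_ - _).
  have [cs [_ csE]] := Ws.
  rewrite (csE _ (twistV_so A soj) _ orthonormal_std).
  rewrite (csE _ soj _ orthonormal_std).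
  by apply: eq_bigr => cw _; rewrite trace_inv_twistV.
have uinvU B j : orthogonal_mx B -> so_valued j ->
    form_of u (twistU B j) = form_of u j.
  move=> orthB soj; rewrite !uE invU //; congr (_ - _).
  have [cs [_ csE]] := Ws.
  have onB := orthonormal_mul (orthogonal_tr orthB) orthonormal_std.
  by rewrite (csE _ (twistU_so B soj) _ orthonormal_std) (csE _ soj _ onB).
have fixed (T T' : (slots -> R) -> slots -> R) :
    (forall v w, \sum_p T v p * w p = \sum_p v p * T' w p) ->
    (forall v, (forall j, so_valued j -> form_of v j = 0) ->
       forall j, so_valued j -> form_of (T' v) j = 0) ->
    (forall j, so_valued j -> form_of (T u) j = form_of u j) ->
    forall p, T u p = u p.
  move=> adj stable same; pose v p := T u p - u p.
  have v0 j : so_valued j -> form_of v j = 0.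
    move=> soj; rewrite -[RHS](subrr (form_of u j)) -{1}same // /form_of -sumrB.
    by apply: eq_bigr => p _; rewrite mulrBl.
  have : \sum_p v p ^+ 2 = 0.
    transitivity (\sum_p u p * T' v p - \sum_p u p * v p).
      rewrite -adj -sumrB; apply: eq_bigr => p _.
      by rewrite expr2 {1}/v mulrBl.
    by rewrite !orth ?subrr //; apply: trace_expressible0 => //; apply: stable.
  move/eqP; rewrite psumr_eq0 => [/allP v2 p|p _]; last exact: sqr_ge0.
  have := v2 p; rewrite mem_index_enum sqrf_eq0 subr_eq0.
  by move=> /(_ isT)/eqP.
have actVu A I K : orthogonal_mx A -> act A (fun I' => u (I', K)) I = u (I, K).
  move=> orthA; apply: (fixed (actV A) (actV A^T) _ _ _ (I, K)).
  - exact: actV_adjoint.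
  - by move=> v v0 j soj; rewrite form_of_actV v0 //; apply: twistV_so.
  - by move=> j soj; rewrite form_of_actV uinvV //; apply: orthogonal_tr.
have actUu B I K : orthogonal_mx B -> act B (fun K' => u (I, K')) K = u (I, K).
  move=> orthB; apply: (fixed (actU B) (actU B^T) _ _ _ (I, K)).
  - exact: actU_adjoint.
  - by move=> v v0 j soj; rewrite form_of_actU v0 //; apply: twistU_so.
  - by move=> j soj; rewrite form_of_actU uinvU //; apply: orthogonal_tr.
have u0 K I : u (I, K) = 0.
  apply: (@orthogonal_fft R m _ (fun I => u (I, K))) => [A orthA I'|kapV perfV].
    exact: actVu.
  pose c K := \sum_I u (relabel I kapV, K).
  apply: (@orthogonal_fft R r _ c) => [B orthB K'|kapU perfU].
    rewrite /act /c; under eq_bigr do rewrite mulr_sumr.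
    by rewrite exchange_big; apply: eq_bigr => I' _; apply: actUu.
  have [c' [w [admw wE]]] :=
    @pairing_trace_inv R m r d q dq kapV kapU perfV perfU.
  (* The tensor that represents the complete contraction along the pairings. *)
  pose del (p : slots) : R := \sum_(K : {ffun 'I_d -> 'I_r})
    \sum_(I : {ffun 'I_d * bool -> 'I_m})
      ((relabel I kapV, relabel K kapU) == p)%:R.
  have pick (F : slots -> R) :
      \sum_p F p * del p = \sum_K \sum_I F (relabel I kapV, relabel K kapU).
    rewrite /del; under eq_bigr do rewrite mulr_sumr.
    rewrite exchange_big; apply: eq_bigr => K1 _.
    under eq_bigr do rewrite mulr_sumr.
    rewrite exchange_big; apply: eq_bigr => I1 _ /=.
    rewrite (bigD1 (relabel I1 kapV, relabel K1 kapU)) //= eqxx mulr1.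
    by rewrite big1 ?addr0 // => p; rewrite eq_sym => /negPf->; rewrite mulr0.
  rewrite -pick; apply: orth; exists [:: (c', w)].
  split; first by rewrite /= admw.
  move=> j soj Z onZ; rewrite big_seq1 -wE //.
  rewrite -(pick (fun p => jtensor j p.1 p.2)).
  by apply: eq_bigr => p _; rewrite mulrC.
suff <- : s = t by [].
by apply/funext => -[I K]; apply/eqP; rewrite eq_sym -subr_eq0; apply/eqP/u0.
Qed.

End InvariantForms.

(** * Curvature in the left invariant frame *)

Section Frames.
Local Open Scope classical_set_scope.
Variables (R : realType) (m r : nat).
Local Notation vec := 'cV[R]_(m + r).
Implicit Types (j : {linear 'cV[R]_r -> 'M[R]_m}) (x y z u v w p : vec).

(** The vector j_z x; as a function of z it is the transpose of ad_x. *)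
Definition jop j z x : vec := col_mx (j (dsubmx z) *m usubmx x) 0.

(** The Levi-Civita connection of left invariant fields is ([x, y] - ad_x^* y -
    ad_y^* x) / 2, and this is its symmetric part. It is also what the
    Christoffel symbols of the exponential chart become in the left invariant
    frame. *)
Definition sym_part j x y := - 2^-1 *: (jop j y x + jop j x y).

Definition nab j x y := 2^-1 *: br j x y + sym_part j x y.

(** The differential at p of the left translation by -p: it maps a tangent
    vector at p to its components in the left invariant frame. *)
Definition theta j p v := v - 2^-1 *: br j p v.

Definition theta_inv j p v := v + 2^-1 *: br j p v.

(** The components of nabla_u (nabla_v w) for vector fields u, v, w that are
    constant in the chart and have components x, y, z at the given point. *)
Definition second_cov j x y z :=
  - 2^-1 *: (sym_part j (br j x y) z + sym_part j y (br j x z))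
  + nab j x (sym_part j y z).

Definition curv_op j x y z := second_cov j x y z - second_cov j y x z.

Lemma dot_split (a b : vec) :
  dot a b = dot (usubmx a) (usubmx b) + dot (dsubmx a) (dsubmx b).
Proof.
rewrite /dot big_split_ord; congr (_ + _).
  by apply: eq_bigr => i _; rewrite !mxE.
by apply: eq_bigr => i _; rewrite !mxE.
Qed.

Lemma br_linl j y : linear (br j ^~ y).
Proof.
move=> c x x'; rewrite /br scale_col_mx add_col_mx scaler0 addr0.
congr col_mx; apply/colP => a.
rewrite !mxE linearP /= mulmxDr -scalemxAr dotC dotDr dotZr.
by rewrite ![dot _ (_ *m _)]dotC.
Qed.

Lemma br_linr j x : linear (br j x).
Proof. by move=> c y y'; rewrite brDr brZr. Qed.

Lemma jop_linl j x : linear (jop j ^~ x).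
Proof.
move=> c z z'; rewrite /jop scale_col_mx add_col_mx scaler0 addr0.
by rewrite !linearP /= mulmxDl -scalemxAl.
Qed.

Lemma jop_linr j z : linear (jop j z).
Proof.
move=> c x x'; rewrite /jop scale_col_mx add_col_mx scaler0 addr0.
by rewrite linearP /= mulmxDr -scalemxAr.
Qed.

Lemma scale_lin a c u v : a *: (c *: u + v) = c *: (a *: u) + a *: v.
Proof. by rewrite scalerDr !scalerA mulrC. Qed.

Lemma add_lin c u v x y : (c *: u + v) + (c *: x + y) = c *: (u + x) + (v + y).
Proof. by rewrite addrACA -scalerDr. Qed.

Lemma sub_lin c u v x y : (c *: u + v) - (c *: x + y) = c *: (u - x) + (v - y).
Proof. by rewrite opprD addrACA -scalerBr. Qed.

Lemma sym_partC j x y : sym_part j x y = sym_part j y x.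
Proof. by rewrite /sym_part addrC. Qed.

Lemma sym_part_vertical j x y :
  usubmx x = 0 -> usubmx y = 0 -> sym_part j x y = 0.
Proof.
by move=> x0 y0; rewrite /sym_part /jop x0 y0 !mulmx0 col_mx0 addr0 scaler0.
Qed.

Lemma sym_part_linr j x : linear (sym_part j x).
Proof.
by move=> c y y'; rewrite /sym_part jop_linl jop_linr add_lin scale_lin.
Qed.

Lemma sym_part_linl j y : linear (sym_part j ^~ y).
Proof.
move=> c x x'; rewrite sym_partC sym_part_linr.
by rewrite ![sym_part j y _]sym_partC.
Qed.

Lemma nab_linl j y : linear (nab j ^~ y).
Proof.
by move=> c x x'; rewrite /nab br_linl sym_part_linl scale_lin add_lin.
Qed.

Lemma nab_linr j x : linear (nab j x).
Proof.
by move=> c y y'; rewrite /nab br_linr sym_part_linr scale_lin add_lin.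
Qed.

Lemma theta_lin j p : linear (theta j p).
Proof.
by move=> c v w; rewrite /theta br_linr -!scaleNr scale_lin add_lin.
Qed.

Lemma second_cov_lin1 j y z : linear (fun x => second_cov j x y z).
Proof.
move=> c x x'; rewrite /second_cov !br_linl.
rewrite sym_part_linl sym_part_linr nab_linl.
by rewrite add_lin scale_lin add_lin.
Qed.

Lemma second_cov_lin2 j x z : linear (fun y => second_cov j x y z).
Proof.
move=> c y y'; rewrite /second_cov br_linr !sym_part_linl nab_linr.
by rewrite add_lin scale_lin add_lin.
Qed.

Lemma second_cov_lin3 j x y : linear (fun z => second_cov j x y z).
Proof.
move=> c z z'; rewrite /second_cov br_linr !sym_part_linr nab_linr.
by rewrite add_lin scale_lin add_lin.
Qed.

Lemma linear_at0 (f : vec -> vec) : linear f -> f 0 = 0.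
Proof. by move=> /(_ (-1) 0 0); rewrite scaler0 addr0 scaleN1r addNr. Qed.

Lemma linear_expand (f : vec -> vec) : linear f ->
  forall v, f v = (\matrix_(i, k) f (delta_mx k 0) i 0) *m v.
Proof.
move=> linf v; have f0 := linear_at0 linf.
have fD : {morph f : x y / x + y}.
  by move=> x y; have := linf 1 x y; rewrite !scale1r.
have fZ c x : f (c *: x) = c *: f x by have := linf c x 0; rewrite f0 !addr0.
have -> : f v = \sum_k v k 0 *: f (delta_mx k 0).
  rewrite {1}(matrix_sum_delta v) (big_morph f fD f0); apply: eq_bigr => k _.
  by rewrite big_ord1 fZ.
apply/colP => i; rewrite summxE !mxE; apply: eq_bigr => k _.
by rewrite !mxE mulrC.
Qed.

Lemma usub_theta j p v : usubmx (theta j p v) = usubmx v.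
Proof. by rewrite linearB linearZ /= col_mxKu scaler0 subr0. Qed.

Lemma br_thetal j p u v : br j (theta j p u) v = br j u v.
Proof. by rewrite /br usub_theta. Qed.

Lemma br_thetar j p u v : br j u (theta j p v) = br j u v.
Proof. by rewrite /br usub_theta. Qed.

Lemma br_brr j u v w : br j u (br j v w) = 0.
Proof. by apply: br_centralr; rewrite col_mxKu. Qed.

Lemma theta_br j p u v : theta j p (br j u v) = br j u v.
Proof. by rewrite /theta br_brr scaler0 subr0. Qed.

Lemma thetaK j p : cancel (theta j p) (theta_inv j p).
Proof. by move=> v; rewrite /theta_inv br_thetar /theta subrK. Qed.

Lemma theta_invK j p : cancel (theta_inv j p) (theta j p).
Proof.
by move=> v; rewrite /theta /theta_inv brDr brZr br_brr scaler0 addr0 addrK.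
Qed.

Lemma dot_linl c (a b v : vec) : dot (c *: a + b) v = c * dot a v + dot b v.
Proof. by rewrite dotC dotDr dotZr ![dot v _]dotC. Qed.

Lemma dot0l n (a : 'cV[R]_n) : dot 0 a = 0.
Proof. by rewrite dotC dot0r. Qed.

Lemma dotZl n c (a b : 'cV[R]_n) : dot (c *: a) b = c * dot a b.
Proof. by rewrite dotC dotZr dotC. Qed.

Lemma dotNr n (a b : 'cV[R]_n) : dot a (- b) = - dot a b.
Proof. by rewrite -scaleN1r dotZr mulN1r. Qed.

Lemma dot_br j z x y : dot z (br j x y) = dot (jop j z x) y.
Proof.
have := brP j (usubmx x) (usubmx y) (dsubmx z).
rewrite /br !(col_mxKu, col_mxKd) !dot_split !(col_mxKu, col_mxKd).
by rewrite dot0r add0r dot0l addr0 => ->.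
Qed.

(** All functions differentiated below, except the tensor components, are at
    most quadratic on lines. *)
Lemma is_derive_quadratic (V W : normedModType R) (f : V -> W)
    (p v : V) (w w2 : W) :
  (forall h, f (h *: v + p) = f p + h *: w + h ^+ 2 *: w2) -> is_derive p v f w.
Proof.
move=> fE; have lim0 : (w + h *: w2) @[h --> (0 : R)^'] --> w.
  rewrite -[X in _ --> X]addr0 -(scale0r w2).
  apply: cvgD; first exact: cvg_cst.
  apply: cvgZr_tmp; exact: cvg_within.
have lim : (fun h => h^-1 *: ((f \o shift p) (h *: v) - f p)) @ (0 : R)^' --> w.
  apply: cvg_trans lim0; apply: near_eq_cvg; near=> h.
  have h0 : h != 0 by near: h; exact: nbhs_dnbhs_neq.
  rewrite /= fE -[f p + _ + _]addrA [f p + _]addrC addrK.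
  rewrite scalerDr scalerA mulVf // scale1r.
  by rewrite scalerA expr2 mulKf.
by apply: DeriveDef; [apply/cvg_ex; exists w|apply: cvg_lim lim].
Unshelve. all: by end_near. Qed.

Lemma br_shift j h u p v : br j (h *: u + p) v = br j p v + h *: br j u v.
Proof. by rewrite br_linl addrC. Qed.

Lemma theta_shift j h u p v :
  theta j (h *: u + p) v = theta j p v + h *: (- 2^-1 *: br j u v).
Proof.
rewrite /theta br_shift scalerDr opprD addrA scaleNr scalerN !scalerA.
by rewrite [h * _]mulrC.
Qed.

Lemma derive_gmul j p v : 'D_v (gmul j (- p)) p = theta j p v.
Proof.
have brN x y : br j (- x) y = - br j x y.
  by have := br_linl j y (-1) x 0;
    rewrite !scaleN1r (linear_at0 (br_linl j y)) !addr0.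
have : is_derive p v (gmul j (- p)) (theta j p v).
  apply: (is_derive_quadratic (w2 := 0)) => h; rewrite scaler0 addr0.
  rewrite /gmul /theta !brN br_linr; move: (br j p v) (br j p p) => b1 b2.
  by apply/matrixP => i k; rewrite !mxE; ring.
by move=> ?; rewrite derive_val.
Qed.

Definition theta_mx j p : 'M[R]_(m + r) :=
  \matrix_(i, k) theta j p (delta_mx k 0) i 0.

Lemma theta_mxE j p v : theta j p v = theta_mx j p *m v.
Proof. exact: linear_expand (theta_lin j p) v. Qed.

Lemma theta_mx_unit j p : theta_mx j p \in unitmx.
Proof.
pose inv : 'M[R]_(m + r) := \matrix_(i, k) theta_inv j p (delta_mx k 0) i 0.
apply: (@mulmx1_unit _ _ _ inv _).1; apply/matrixP => i k.
have := congr1 (fun v => v i 0) (theta_invK j p (delta_mx k 0)).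
rewrite theta_mxE !mxE eqxx andbT => <-; apply: eq_bigr => l _.
by rewrite !mxE.
Qed.

Lemma gmetricE j p : gmetric j p = (theta_mx j p)^T *m theta_mx j p.
Proof.
apply/matrixP => a b; rewrite !mxE !derive_gmul /dot; apply: eq_bigr => i _.
by rewrite !mxE.
Qed.

Lemma ip_gmetric j p u v :
  ip (gmetric j) p u v = dot (theta j p u) (theta j p v).
Proof.
rewrite /ip gmetricE !theta_mxE mulmxA -trmx_mul -mulmxA mxE.
by apply: eq_bigr => i _; rewrite mxE.
Qed.

Lemma derive_ip j p w u v :
  'D_w (fun x => ip (gmetric j) x u v) p
  = - 2^-1 * (dot (br j w u) (theta j p v) + dot (theta j p u) (br j w v)).
Proof.
have : is_derive p w (fun x => ip (gmetric j) x u v)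
  (- 2^-1 * (dot (br j w u) (theta j p v) + dot (theta j p u) (br j w v))).
  apply: (is_derive_quadratic (w2 := 4^-1 * dot (br j w u) (br j w v))) => h.
  rewrite !ip_gmetric !theta_shift.
  have e (a b c d : vec) :
      dot (a + b) (c + d) = dot a c + dot a d + dot b c + dot b d :> R.
    rewrite dotDr ![dot (_ + _) _]dotC !dotDr.
    by rewrite ![dot c _]dotC ![dot d _]dotC; ring.
  by rewrite e !(dotZr, dotZl) /GRing.scale /=; field.
by move=> ?; rewrite derive_val.
Qed.

Lemma jop_theta j z p v : jop j z (theta j p v) = jop j z v.
Proof. by rewrite /jop usub_theta. Qed.

Lemma dot_thetar_jop j p z x v :
  dot (jop j z x) (theta j p v) = dot (jop j z x) v.
Proof. by rewrite -!dot_br br_thetar. Qed.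

Lemma koszulE j p u v w : so_valued j ->
  koszul (gmetric j) p u v w
  = dot (sym_part j (theta j p u) (theta j p v)) (theta j p w).
Proof.
move=> soj; rewrite /koszul !derive_ip /sym_part dotZl.
rewrite [dot (_ + _) _]dotC dotDr ![dot (theta j p w) _]dotC !dot_thetar_jop.
rewrite !jop_theta -!dot_br.
rewrite (br_skew w u soj) (br_skew w v soj) (br_skew v u soj).
by rewrite ![dot (br j _ _) _]dotC ![dot (- _) _]dotC !dotNr; field.
Qed.

(** theta is an isometry onto the standard inner product, so it suffices to read
    off Koszul's formula as an inner product with theta w. *)
Lemma theta_christoffel j p u v : so_valued j ->
  theta j p (christoffel (gmetric j) p u v)
  = sym_part j (theta j p u) (theta j p v).
Proof.
move=> soj; rewrite -[RHS](theta_invK j p); congr theta.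
have gU : gmetric j p \in unitmx.
  by rewrite gmetricE unitmx_mul unitmx_tr theta_mx_unit.
apply: (can_inj (mulKmx gU)); rewrite /christoffel mulKVmx //.
apply/colP => k; rewrite mxE koszulE // -{1}(theta_invK j p (sym_part _ _ _)).
rewrite dotC -ip_gmetric /ip -mulmxA trmx_delta -rowE.
by rewrite [LHS]mxE.
Qed.

Lemma derive_christoffel j p u v w : so_valued j ->
  theta j p ('D_u (fun x => christoffel (gmetric j) x v w) p)
  = - 2^-1 *: (sym_part j (br j u v) (theta j p w)
               + sym_part j (theta j p v) (br j u w))
    + 2^-1 *: br j u (sym_part j (theta j p v) (theta j p w)).
Proof.
move=> soj.
have chrE x : christoffel (gmetric j) x v w
    = theta_inv j x (sym_part j (theta j x v) (theta j x w)).
  by rewrite -theta_christoffel // thetaK.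
set F := sym_part j (theta j p v) (theta j p w).
set F' := - 2^-1 *: _.
have : is_derive p u (fun x => christoffel (gmetric j) x v w)
   (theta_inv j p F' + 2^-1 *: br j u F).
  apply: (is_derive_quadratic (w2 := 2^-1 *: br j u F')) => h.
  rewrite !chrE !theta_shift.
  have -> : sym_part j (theta j p v + h *: (- 2^-1 *: br j u v))
      (theta j p w + h *: (- 2^-1 *: br j u w)) = F + h *: F'.
    rewrite ![_ + h *: _]addrC sym_part_linl !sym_part_linr.
    rewrite [X in h *: (h *: X + _)]sym_part_vertical ?scaler0 ?add0r;
      first last.
    - by rewrite linearZ /= col_mxKu scaler0.
    - by rewrite linearZ /= col_mxKu scaler0.
    have lin_scale (f : vec -> vec) c a : linear f -> f (c *: a) = c *: f a.
      by move=> linf; have := linf c a 0; rewrite (linear_at0 linf) !addr0.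
    rewrite (lin_scale (sym_part j ^~ _)); last exact: sym_part_linl.
    rewrite (lin_scale (sym_part j _)); last exact: sym_part_linr.
    rewrite /F' /F.
    move: (sym_part j _ _) (sym_part j _ _) (sym_part j _ _) => a b c.
    by apply/colP => i; rewrite !mxE; ring.
  rewrite -/F /theta_inv br_shift ![F + h *: F']addrC !br_linr.
  move: F F' (br j p F') (br j p F) (br j u F') (br j u F) => G G' a b c e.
  by apply/colP => i; rewrite !mxE; field.
move=> ?; rewrite derive_val.
have addth a b : theta j p (a + b) = theta j p a + theta j p b.
  by have := theta_lin j p 1 a b; rewrite !scale1r.
rewrite addth theta_invK; congr (_ + _).
have := theta_lin j p 2^-1 (br j u F) 0; rewrite !addr0 theta_br.
by rewrite (linear_at0 (theta_lin j p)) addr0.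
Qed.

Lemma cov_cst g p u v :
  cov g (cst u) (cst v) p = christoffel g p u v :> vec.
Proof. by rewrite /cov derive_cst add0r. Qed.

Lemma theta_curvature j p u v w : so_valued j ->
  theta j p (curvature (gmetric j) (cst u) (cst v) (cst w) p)
  = curv_op j (theta j p u) (theta j p v) (theta j p w).
Proof.
move=> soj.
have addth a b : theta j p (a + b) = theta j p a + theta j p b.
  by have := theta_lin j p 1 a b; rewrite !scale1r.
have thB a b : theta j p (a - b) = theta j p a - theta j p b.
  by have := theta_lin j p (-1) b a; rewrite !scaleN1r ![- _ + _]addrC.
have chr0 : christoffel (gmetric j) p 0 w = 0.
  apply: (can_inj (thetaK j p)); rewrite theta_christoffel //.
  rewrite (linear_at0 (theta_lin j p)).
  exact: (linear_at0 (sym_part_linl j _)).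
have covE a b :
    theta j p (cov (gmetric j) (cst a) (cov (gmetric j) (cst b) (cst w)) p)
    = second_cov j (theta j p a) (theta j p b) (theta j p w).
  have -> : cov (gmetric j) (cst b) (cst w)
      = fun x => christoffel (gmetric j) x b w.
    by apply/funext => x; apply: cov_cst.
  rewrite /cov /= addth derive_christoffel // !theta_christoffel //.
  by rewrite /second_cov /nab !br_thetal !br_thetar -!addrA.
have lie0 : cov (gmetric j) (lie (cst u) (cst v)) (cst w) p = 0.
  by rewrite /cov /lie !derive_cst subrr add0r chr0.
rewrite /curvature lie0 subr0 thB.
by congr (_ - _); [apply: covE u v | apply: covE v u].
Qed.

Definition upd_at (X : nat -> vec) i v := fun s => if s == i then v else X s.

(** The components of nabla^k R in the left invariant frame. They are constant,
    so a covariant derivative only involves the derivatives of the frame. The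
    arguments are the first 4 + k terms of a sequence of vectors, the direction
    of the last derivative coming first. *)
Fixpoint tau k j (X : nat -> vec) : R := match k with
  | 0 => dot (curv_op j (X 0%N) (X 1%N) (X 2%N)) (X 3%N)
  | k'.+1 => - \sum_(i < 4 + k')
      tau k' j (upd_at (X \o succn) i (nab j (X 0%N) (X i.+1)))
  end.

Definition multilinear n (phi : (nat -> vec) -> R) := forall i X c u v,
  (i < n)%N ->
  phi (upd_at X i (c *: u + v)) = c * phi (upd_at X i u) + phi (upd_at X i v).

Lemma upd_atC X i k u v : i != k ->
  upd_at (upd_at X i u) k v = upd_at (upd_at X k v) i u.
Proof.
move=> ik; apply/funext => s; rewrite /upd_at.
by case: eqVneq => [->|//]; rewrite eq_sym (negPf ik).
Qed.

Lemma upd_at_upd X i u v : upd_at (upd_at X i u) i v = upd_at X i v.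
Proof. by apply/funext => s; rewrite /upd_at; case: eqP. Qed.

Lemma upd_at_shift0 X v : upd_at X 0 v \o succn = X \o succn.
Proof. by []. Qed.

Lemma upd_at_shift X i v : upd_at X i.+1 v \o succn = upd_at (X \o succn) i v.
Proof. by []. Qed.

Lemma tau_multilinear k j : multilinear (4 + k) (tau k j).
Proof.
elim: k => [|k IHk] i X c u v.
  have curv1 y z : linear (fun x => curv_op j x y z).
    by move=> a x x'; rewrite /curv_op second_cov_lin1 second_cov_lin2 sub_lin.
  have curv2 x z : linear (fun y => curv_op j x y z).
    by move=> a y y'; rewrite /curv_op second_cov_lin1 second_cov_lin2 sub_lin.
  have curv3 x y : linear (fun z => curv_op j x y z).
    by move=> a z z'; rewrite /curv_op !second_cov_lin3 sub_lin.
  case: i => [|[|[|[|//]]]] _ /=; rewrite /upd_at /=.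
  - by rewrite curv1 dot_linl.
  - by rewrite curv2 dot_linl.
  - by rewrite curv3 dot_linl.
  - by rewrite dotDr dotZr.
move=> lti; rewrite /= mulrN -opprD mulr_sumr -big_split /=; congr (- _).
apply: eq_bigr => l _; case: i lti => [|i] lti.
  have hd w : upd_at X 0%N w 0%N = w by [].
  have tl w : upd_at X 0%N w l.+1 = X l.+1 by [].
  by rewrite !upd_at_shift0 !hd !tl nab_linl IHk // ltn_ord.
have hd w : upd_at X i.+1 w 0%N = X 0%N by [].
have tl w : upd_at X i.+1 w l.+1 = if (l : nat) == i then w else X l.+1 by [].
rewrite !upd_at_shift !hd !tl; have [li|li] := eqVneq (l : nat) i.
  by rewrite li !upd_at_upd nab_linr IHk // -li ltn_ord.
by rewrite !(@upd_atC _ i) 1?eq_sym // IHk.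
Qed.

End Frames.

(** * Covariant derivatives of the curvature *)

Section CovariantDerivatives.
Local Open Scope classical_set_scope.
Variables (R : realType) (m r : nat).
Local Notation vec := 'cV[R]_(m + r).
Implicit Types (j : {linear 'cV[R]_r -> 'M[R]_m}) (u v w p : vec).
Implicit Types (X : nat -> vec) (phi : (nat -> vec) -> R).

Lemma multilinear_expand n phi X i v : multilinear n phi -> (i < n)%N ->
  phi (upd_at X i v) = \sum_a v a 0 * phi (upd_at X i (delta_mx a 0)).
Proof.
move=> lin ltin; pose f v := phi (upd_at X i v).
have f0 : f 0 = 0.
  have := lin i X (-1) 0 0 ltin; rewrite scaler0 addr0 -/(f 0).
  by rewrite mulN1r addNr.
have fD : {morph f : x y / x + y}.
  by move=> x y; have := lin i X 1 x y ltin; rewrite scale1r mul1r.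
have fZ c x : f (c *: x) = c * f x.
  by have := lin i X c x 0 ltin; rewrite addr0 -!/(f _) f0 addr0.
rewrite -/(f v) {1}(matrix_sum_delta v) (big_morph f fD f0).
by apply: eq_bigr => a _; rewrite big_ord1 fZ.
Qed.

(** The product rule, by induction on the number k of slots that vary: the last
    of them is expanded in coordinates, which fixes it to a basis vector. *)
Lemma is_derive_multilinear n phi (Xf : vec -> nat -> vec) X' p w :
  multilinear n phi ->
  (forall s a, is_derive p w (fun x => Xf x s a 0) (X' s a 0)) ->
  forall k Y, (k <= n)%N ->
  is_derive p w (fun x => phi (fun s => if (s < k)%N then Xf x s else Y s))
    (\sum_(i < k) phi
       (upd_at (fun s => if (s < k)%N then Xf p s else Y s) i (X' i))).
Proof.
move=> lin dX; elim=> [|k IHk] Y lekn.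
  rewrite big_ord0; have -> : (fun x => phi (fun s =>
      if (s < 0)%N then Xf x s else Y s)) = cst (phi Y) by [].
  exact: is_derive_cst.
pose mix x Y := fun s => if (s < k)%N then Xf x s else Y s.
have mixS x : (fun s => if (s < k.+1)%N then Xf x s else Y s)
    = upd_at (mix x Y) k (Xf x k).
  apply/funext => s; rewrite /upd_at /mix ltnS leq_eqVlt.
  by case: eqP => [->|].
have mixY x v : upd_at (mix x Y) k v = mix x (upd_at Y k v).
  apply/funext => s; rewrite /upd_at /mix.
  by case: eqVneq => [->|//]; rewrite ltnn.
have -> : (fun x => phi (fun s => if (s < k.+1)%N then Xf x s else Y s))
    = \sum_(a < m + r) (fun x => Xf x k a 0)
        * (fun x => phi (mix x (upd_at Y k (delta_mx a 0)))).
  apply/funext => x; rewrite mixS (multilinear_expand _ _ lin) // fct_sumE.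
  by apply: eq_bigr => a _; rewrite mixY.
have dprod a :=
  is_deriveM (dX k a) (IHk (upd_at Y k (delta_mx a 0)) (ltnW lekn)).
have dsum := is_derive_sum dprod.
apply: is_derive_eq dsum _.
have mixp a :
    (fun s => if (s < k)%N then Xf p s else upd_at Y k (delta_mx a 0) s)
    = upd_at (mix p Y) k (delta_mx a 0) by rewrite mixY.
rewrite big_split [RHS]big_ord_recr !mixS /=; congr (_ + _).
  under eq_bigr do rewrite scaler_sumr.
  rewrite exchange_big; apply: eq_bigr => i _ /=.
  have ki : k != i by rewrite gtn_eqF.
  rewrite upd_atC // (multilinear_expand _ _ lin) //.
  by apply: eq_bigr => a _; rewrite mixp upd_atC.
rewrite upd_at_upd (multilinear_expand _ _ lin) //.
by apply: eq_bigr => a _; rewrite mixY [RHS]mulrC.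
Qed.

(** The derivative of the frame components along a constant field u accounts for
    the part [u, v] / 2 of the connection, and the Christoffel symbols for its
    symmetric part. *)
Lemma tau_frame k j p (vs : seq vec) : so_valued j -> size vs = (4 + k)%N ->
  nabla_riem (gmetric j) k p vs = tau k j (fun s => theta j p (nth 0 vs s)).
Proof.
move=> soj; elim: k p vs => [|k IHk] p vs.
  case: vs => [|u [|v [|w [|z [|]]]]] //= _.
  by rewrite /nabla_riem /= ip_gmetric theta_curvature.
case: vs => // u vs [sz]; rewrite /nabla_riem /= -/(nabla_riem (gmetric j) k).
have th0 x : theta j x 0 = 0 := linear_at0 (theta_lin j x).
have tail x : (fun s => theta j x (nth 0 vs s))
    = fun s => if (s < 4 + k)%N then theta j x (nth 0 vs s) else 0.
  apply/funext => s; case: ltnP => // les.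
  by rewrite nth_default ?th0 // sz.
have -> : (fun x => nabla_riem (gmetric j) k x vs)
    = fun x => tau k j (fun s => theta j x (nth 0 vs s)).
  by apply/funext => x; apply: IHk.
have dth s a : is_derive p u (fun x => theta j x (nth 0 vs s) a 0)
    ((- 2^-1 *: br j u (nth 0 vs s)) a 0).
  apply: (is_derive_quadratic (w2 := 0)) => h.
  by rewrite theta_shift scaler0 addr0 !mxE.
have :=
  is_derive_multilinear (@tau_multilinear R m r k j) dth (fun=> 0) (leqnn _).
under [X in is_derive _ _ X _]funext do rewrite -tail.
move=> dT; rewrite (@derive_val _ _ _ _ _ _ _ dT) -tail -sumrN sz -big_split /=.
rewrite -sumrN; apply: eq_bigr => i _.
have lti : (i < 4 + k)%N := ltn_ord i.
rewrite IHk; last by rewrite size_set_nth sz; apply/maxn_idPr.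
have -> : (fun s => theta j p (nth 0 (set_nth 0 vs i
       (cov (gmetric j) (cst u) (cst (nth 0 vs i)) p)) s))
    = upd_at (fun s => theta j p (nth 0 vs s)) i
        (sym_part j (theta j p u) (theta j p (nth 0 vs i))).
  apply/funext => s; rewrite /upd_at nth_set_nth /=; case: eqVneq => // _.
  by rewrite cov_cst theta_christoffel.
have nabE : nab j (theta j p u) (theta j p (nth 0 vs i))
    = -1 *: (- 2^-1 *: br j u (nth 0 vs i))
      + sym_part j (theta j p u) (theta j p (nth 0 vs i)).
  by rewrite /nab br_thetal br_thetar scaleN1r scaleNr opprK.
rewrite nabE (@tau_multilinear R m r k j _ _ _ _ _ lti) mulN1r opprD opprK.
by congr (_ - _).
Qed.

Lemma theta_eq0 j p v : (theta j p v == 0) = (v == 0).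
Proof.
by rewrite -(can_eq (thetaK j p)) (linear_at0 (theta_lin j p)).
Qed.

Lemma dot_gt0 (v : vec) : v != 0 -> 0 < dot v v.
Proof.
move=> v0; rewrite lt_def; apply/andP; split; last first.
  by apply: sumr_ge0 => i _; rewrite -expr2 sqr_ge0.
apply: contra v0; rewrite psumr_eq0 => [/allP v0|i _];
  last by rewrite -expr2 sqr_ge0.
apply/eqP/colP => i; rewrite mxE; have := v0 i; rewrite mem_index_enum.
by rewrite mulf_eq0 orbb => /(_ isT)/eqP.
Qed.

(** A class of smooth functions that contains the metrics gmetric j and is
    visibly closed under directional derivatives. *)
Definition quadratic_map n (f : vec -> 'M[R]_n) := exists A B C,
  f = fun x => A + \sum_i x i 0 *: B i + \sum_i \sum_k (x i 0 * x k 0) *: C i k.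

Lemma quadratic_map_differentiable n (f : vec -> 'M[R]_n) p :
  quadratic_map f -> differentiable f p.
Proof.
case=> A [B [C ->]].
have -> : (fun x : vec => A + \sum_i x i 0 *: B i
            + \sum_i \sum_k (x i 0 * x k 0) *: C i k)
    = cst A + \sum_i (fun x : vec => x i 0 *: B i)
      + \sum_i \sum_k (fun x : vec => (x i 0 * x k 0) *: C i k).
  apply/funext => x; rewrite !fctE !fct_sumE; congr (_ + _).
  by apply: eq_bigr => i _; rewrite fct_sumE.
have dc i : differentiable (fun x : vec => x i 0 : R) p.
  exact: differentiable_coord.
apply: differentiableD; first apply: differentiableD.
- exact: differentiable_cst.
- by apply: differentiable_sum => i; apply: differentiableZl.
- apply: differentiable_sum => i; apply: differentiable_sum => k.
  by apply: differentiableZl; apply: differentiableM.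
Qed.

Lemma quadratic_map_derive n (f : vec -> 'M[R]_n) v :
  quadratic_map f -> quadratic_map ('D_v f).
Proof.
case=> A [B [C fE]].
exists (\sum_i v i 0 *: B i).
exists (fun i => \sum_k v k 0 *: (C i k + C k i)), (fun _ _ => 0).
apply/funext => p.
have : is_derive p v f (\sum_i v i 0 *: B i
    + \sum_i p i 0 *: (\sum_k v k 0 *: (C i k + C k i))).
  apply: (is_derive_quadratic
    (w2 := \sum_i \sum_k (v i 0 * v k 0) *: C i k)) => h.
  have -> : \sum_i p i 0 *: (\sum_k v k 0 *: (C i k + C k i))
      = \sum_i \sum_k (p i 0 * v k 0 + v i 0 * p k 0) *: C i k.
    transitivity (\sum_i \sum_k (p i 0 * v k 0) *: C i k
                  + \sum_i \sum_k (p i 0 * v k 0) *: C k i).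
      rewrite -big_split; apply: eq_bigr => i _ /=.
      rewrite -big_split scaler_sumr; apply: eq_bigr => k _ /=.
      by rewrite scalerA scalerDr.
    rewrite [X in _ + X]exchange_big -big_split; apply: eq_bigr => i _ /=.
    rewrite -big_split; apply: eq_bigr => k _ /=.
    by rewrite scalerDl [v i 0 * _]mulrC.
  have lin : \sum_i (h *: v + p) i 0 *: B i
      = \sum_i p i 0 *: B i + h *: \sum_i v i 0 *: B i.
    rewrite scaler_sumr -big_split; apply: eq_bigr => i _ /=.
    by rewrite !mxE scalerDl scalerA addrC.
  have quad : \sum_i \sum_k ((h *: v + p) i 0 * (h *: v + p) k 0) *: C i k
      = \sum_i \sum_k (p i 0 * p k 0) *: C i k
        + h *: (\sum_i \sum_k (p i 0 * v k 0 + v i 0 * p k 0) *: C i k)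
        + h ^+ 2 *: (\sum_i \sum_k (v i 0 * v k 0) *: C i k).
    rewrite !scaler_sumr -!big_split; apply: eq_bigr => i _ /=.
    rewrite !scaler_sumr -!big_split; apply: eq_bigr => k _ /=.
    by rewrite !scalerA -!scalerDl !mxE; congr (_ *: _); ring.
  rewrite fE lin quad; move: (A) (\sum_i p i 0 *: B i) (\sum_i v i 0 *: B i).
  move: (\sum_i \sum_k _) (\sum_i \sum_k _) (\sum_i \sum_k _) => a b c A' d e.
  by apply/matrixP => i k; rewrite !mxE; ring.
move=> ?; rewrite derive_val; rewrite [X in _ = _ + X]big1 ?addr0 // => i _.
by rewrite big1 // => k _; rewrite scaler0.
Qed.

Lemma quadratic_map_smooth (f : vec -> 'M[R]_(m + r)) :
  quadratic_map f -> smooth f.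
Proof.
move=> qf vs p; apply: quadratic_map_differentiable.
by elim: vs => //= v vs IHvs; apply: quadratic_map_derive.
Qed.

Lemma gmetric_quadratic j : quadratic_map (gmetric j).
Proof.
pose L i := - 2^-1 *:
  \matrix_(a, k) br j (delta_mx i 0) (delta_mx k 0 : vec) a 0.
have thE x : theta_mx j x = 1%:M + \sum_i x i 0 *: L i.
  apply/matrixP => a k; rewrite mxE [RHS]mxE summxE /theta.
  have -> : br j x (delta_mx k 0)
      = \sum_i x i 0 *: br j (delta_mx i 0) (delta_mx k 0).
    pose f y := br j y (delta_mx k 0).
    have fD : {morph f : y y' / y + y'}.
      by move=> y y'; rewrite /f -{1}[y]scale1r br_linl scale1r.
    have f0 : f 0 = 0 := linear_at0 (br_linl j _).
    rewrite -/(f x) {1}(matrix_sum_delta x) (big_morph f fD f0).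
    apply: eq_bigr => i _; rewrite big_ord1 -[_ *: _ in LHS]addr0 /f br_linl.
    by rewrite -/(f 0) f0 addr0.
  rewrite [LHS]mxE; congr (_ + _); first by rewrite !mxE eqxx andbT.
  rewrite -scaleNr mxE summxE mulr_sumr.
  by apply: eq_bigr => i _; rewrite !mxE; ring.
exists 1%:M, (fun i => (L i)^T + L i), (fun i k => (L i)^T *m L k).
apply/funext => x; rewrite gmetricE thE.
have -> : (1%:M + \sum_i x i 0 *: L i)^T = 1%:M + \sum_i x i 0 *: (L i)^T.
  apply/matrixP => a b; rewrite !mxE !summxE eq_sym; congr (_ + _).
  by apply: eq_bigr => i _; rewrite !mxE.
rewrite mulmxDl mul1mx mulmxDr mulmx1 !mulmx_suml -!addrA; congr (_ + _).
rewrite addrA -big_split; congr (_ + _); apply: eq_bigr => i _ /=.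
  by rewrite scalerDr addrC.
rewrite mulmx_sumr; apply: eq_bigr => k _.
by rewrite -scalemxAl -scalemxAr scalerA.
Qed.

Lemma riemannian_gmetric j : riemannian (gmetric j).
Proof.
split; first exact/quadratic_map_smooth/gmetric_quadratic.
move=> p; split; first by rewrite gmetricE trmx_mul trmxK.
by move=> v v0; rewrite ip_gmetric dot_gt0 // theta_eq0.
Qed.

End CovariantDerivatives.

(** * Polynomial dependence on the bracket *)

Section Polynomiality.
Variables (R : realType) (m r : nat).
Local Notation vec := 'cV[R]_(m + r).
Local Notation brackets := {linear 'cV[R]_r -> 'M[R]_m}.
Implicit Types (j : brackets) (f g : brackets -> R) (v w : brackets -> vec).

Local Notation var := ('I_r * 'I_m * 'I_m)%type.
Definition entry j (x : var) := j (delta_mx x.1.1 0) x.1.2 x.2.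

(** Homogeneous polynomials of degree d in the entries of j, as lists of
    monomials with coefficients. *)
Definition homog d f := exists l : seq (R * d.-tuple var),
  forall j, f j = \sum_(c <- l) c.1 * \prod_(x <- c.2) entry j x.

Lemma homog_ext d f g : f =1 g -> homog d f -> homog d g.
Proof. by move=> fg [l fE]; exists l => j; rewrite -fg. Qed.

Lemma homog0 d : homog d (fun=> 0).
Proof. by exists [::] => j; rewrite big_nil. Qed.

Lemma homog_const c : homog 0 (fun=> c).
Proof. by exists [:: (c, [tuple])] => j; rewrite big_seq1 big_nil mulr1. Qed.

Lemma homog_entry z x y : homog 1 (fun j => j (delta_mx z 0) x y).
Proof.
by exists [:: (1, [tuple (z, x, y)])] => j; rewrite !big_seq1 mul1r.
Qed.

Lemma homog_add d f g : homog d f -> homog d g -> homog d (fun j => f j + g j).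
Proof.
by move=> [l fE] [l' gE]; exists (l ++ l') => j; rewrite fE gE big_cat.
Qed.

Lemma homog_mul d e f g :
  homog d f -> homog e g -> homog (d + e) (fun j => f j * g j).
Proof.
move=> [l fE] [l' gE].
exists [seq (c.1 * c'.1, [tuple of c.2 ++ c'.2])
  | c : R * d.-tuple var <- l, c' : R * e.-tuple var <- l'] => j.
rewrite fE gE big_allpairs_dep mulr_suml; apply: eq_bigr => c _.
rewrite mulr_sumr; apply: eq_bigr => c' _ /=.
by rewrite big_cat /= mulrACA.
Qed.

Lemma homog_scale d c f : homog d f -> homog d (fun j => c * f j).
Proof. exact: homog_mul (homog_const c). Qed.

Lemma homog_sum d (I : eqType) (s : seq I) (Q : pred I)
    (F : I -> brackets -> R) :
  (forall i, i \in s -> homog d (F i)) ->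
  homog d (fun j => \sum_(i <- s | Q i) F i j).
Proof.
elim: s => [|i s IHs] Fh.
  by apply: homog_ext (homog0 d) => j; rewrite big_nil.
have {}IHs := IHs (fun k ks => Fh k (mem_behead (s := i :: s) ks)).
case Qi: (Q i); last by apply: homog_ext IHs => j; rewrite big_cons Qi.
have := homog_add (Fh i (mem_head i s)) IHs.
by apply: homog_ext => j; rewrite big_cons Qi.
Qed.

Lemma homog_exp d n f : homog d f -> homog (n * d) (fun j => f j ^+ n).
Proof.
move=> fh; elim: n => [|n IHn]; first exact: homog_const 1.
by apply: homog_ext (homog_mul fh IHn) => j; rewrite exprS.
Qed.

Lemma homog_prod (I : Type) (s : seq I) (d : I -> nat)
    (F : I -> brackets -> R) :
  (forall i, homog (d i) (F i)) ->
  homog (\sum_(i <- s) d i) (fun j => \prod_(i <- s) F i j).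
Proof.
move=> Fh; elim: s => [|i s IHs].
  by rewrite big_nil; apply: homog_ext (homog_const 1) => j; rewrite big_nil.
rewrite big_cons; apply: homog_ext (homog_mul (Fh i) IHs) => j.
by rewrite big_cons.
Qed.

Definition vhomog d v := forall a, homog d (fun j => v j a 0).

Lemma vhomog_ext d v w : v =1 w -> vhomog d v -> vhomog d w.
Proof. by move=> vw vh a; apply: homog_ext (vh a) => j; rewrite vw. Qed.

Lemma vhomog_const (u : vec) : vhomog 0 (fun=> u).
Proof. by move=> a; apply: homog_const. Qed.

Lemma vhomog_add d v w : vhomog d v -> vhomog d w ->
  vhomog d (fun j => v j + w j).
Proof.
by move=> vh wh a; apply: homog_ext (homog_add (vh a) (wh a)) => j; rewrite mxE.
Qed.

Lemma vhomog_scale d c v : vhomog d v -> vhomog d (fun j => c *: v j).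
Proof.
by move=> vh a; apply: homog_ext (homog_scale c (vh a)) => j; rewrite mxE.
Qed.

Lemma vhomog_br d e v w :
  vhomog d v -> vhomog e w -> vhomog (1 + d + e) (fun j => br j (v j) (w j)).
Proof.
move=> vh wh a; case: (split_ordP a) => [i|z] ->.
  by apply: homog_ext (homog0 _) => j; rewrite col_mxEu mxE.
have comb : homog (1 + d + e) (fun j => \sum_i (\sum_k
    j (delta_mx z 0) i k * v j (lshift r k) 0) * w j (lshift r i) 0).
  apply: homog_sum => i _; apply: homog_mul (wh _).
  by apply: homog_sum => k _; apply: homog_mul (homog_entry z i k) (vh _).
apply: homog_ext comb => j; rewrite col_mxEd mxE /dot.
apply: eq_bigr => i _; rewrite !mxE; congr (_ * _).
by apply: eq_bigr => k _; rewrite mxE.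
Qed.

Lemma vhomog_jop d e v w :
  vhomog d v -> vhomog e w -> vhomog (1 + d + e) (fun j => jop j (v j) (w j)).
Proof.
move=> vh wh a; case: (split_ordP a) => [i|z] ->; last first.
  by apply: homog_ext (homog0 _) => j; rewrite col_mxEd mxE.
have comb : homog (1 + d + e) (fun j => \sum_k (\sum_z
    j (delta_mx z 0) i k * v j (rshift m z) 0) * w j (lshift r k) 0).
  apply: homog_sum => k _; apply: homog_mul (wh _).
  by apply: homog_sum => z _; apply: homog_mul (homog_entry z i k) (vh _).
apply: homog_ext comb => j; rewrite col_mxEu mxE.
apply: eq_bigr => k _; rewrite mxE linear_form_entry; congr (_ * _).
by apply: eq_bigr => z _; rewrite mxE mulrC.
Qed.

Lemma homog_cast d e f : d = e -> homog d f -> homog e f.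
Proof. by move=> ->. Qed.

Lemma vhomog_cast d e v : d = e -> vhomog d v -> vhomog e v.
Proof. by move=> ->. Qed.

Lemma vhomog_sym_part d e v w : vhomog d v -> vhomog e w ->
  vhomog (1 + d + e) (fun j => sym_part j (v j) (w j)).
Proof.
move=> vh wh; apply: vhomog_scale; apply: vhomog_add; last exact: vhomog_jop.
by apply: vhomog_cast (vhomog_jop wh vh); rewrite addnAC.
Qed.

Lemma vhomog_nab d e v w : vhomog d v -> vhomog e w ->
  vhomog (1 + d + e) (fun j => nab j (v j) (w j)).
Proof.
move=> vh wh; apply: vhomog_add; last exact: vhomog_sym_part.
by apply: vhomog_scale; apply: vhomog_br.
Qed.

Lemma vhomog_second_cov x y z : vhomog 2 (fun j => second_cov j x y z).
Proof.
have [hx hy hz] := And3 (vhomog_const x) (vhomog_const y) (vhomog_const z).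
apply: vhomog_add; last exact: vhomog_nab hx (vhomog_sym_part hy hz).
apply: vhomog_scale; apply: vhomog_add.
  exact: vhomog_sym_part (vhomog_br hx hy) hz.
exact: vhomog_sym_part hy (vhomog_br hx hz).
Qed.

(** The curvature tensor is quadratic in j, since the connection is linear in j,
    and each covariant derivative raises the degree by one. *)
Lemma homog_tau k (X : nat -> vec) : homog (2 + k) (fun j => tau k j X).
Proof.
elim: k X => [|k IHk] X.
  rewrite /= /dot; apply: homog_sum => a _.
  apply: homog_mul (homog_const _).
  apply: vhomog_add; first exact: vhomog_second_cov.
  by apply: vhomog_ext (vhomog_scale (-1) (vhomog_second_cov _ _ _)) => j;
    rewrite scaleN1r.
have comb : homog (2 + k.+1) (fun j => -1 * \sum_(i < 4 + k) \sum_a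
    nab j (X 0%N) (X i.+1) a 0
    * tau k j (upd_at (X \o succn) i (delta_mx a 0))).
  apply: homog_scale; apply: homog_sum => i _; apply: homog_sum => a _.
  exact: homog_mul (vhomog_nab (vhomog_const _) (vhomog_const _) a) (IHk _).
apply: homog_ext comb => j; rewrite /= mulN1r; congr (- _).
apply: eq_bigr => i _.
by rewrite (multilinear_expand _ _ (@tau_multilinear R m r k j)).
Qed.

Lemma homog_form d f : homog d f ->
  exists t, forall j, f j = @form_of R m r d t j.
Proof.
case=> l fE.
pose idx (c : R * d.-tuple var) :
    {ffun 'I_d * bool -> 'I_m} * {ffun 'I_d -> 'I_r} :=
  ([ffun s : 'I_d * bool =>
      let x := tnth c.2 s.1 in if s.2 then x.2 else x.1.2],
   [ffun e => (tnth c.2 e).1.1]).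
exists (fun p => \sum_(c <- l) c.1 * (idx c == p)%:R) => j.
rewrite /form_of fE; under [RHS]eq_bigr do rewrite mulr_suml.
rewrite exchange_big; apply: eq_bigr => c _ /=.
rewrite (bigD1 (idx c)) //= eqxx mulr1 [X in _ = _ + X]big1 ?addr0 => [|p].
  rewrite big_tuple /jtensor; congr (_ * _); apply: eq_bigr => e _.
  by rewrite !ffunE.
by rewrite eq_sym => /negPf->; rewrite mulr0 mul0r.
Qed.

End Polynomiality.

(** * Isometries and the value of a curvature invariant *)

Section Main.
Variables (R : realType) (m r : nat).
Local Notation vec := 'cV[R]_(m + r).
Implicit Types (j : {linear 'cV[R]_r -> 'M[R]_m}).

Lemma dot_orthogonal n (g : 'M[R]_n) (x y : 'cV[R]_n) :
  orthogonal_mx g -> dot (g *m x) (g *m y) = dot x y.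
Proof. by move=> og; rewrite dot_mull mulmxA og mul1mx. Qed.

Section Isometry.
Variables (j j' : {linear 'cV[R]_r -> 'M[R]_m}) (g : 'M[R]_(m + r)).
Hypothesis g_orth : orthogonal_mx g.
Hypothesis g_br : forall x y, br j' (g *m x) (g *m y) = g *m br j x y.
Hypothesis g_jop : forall z x, jop j' (g *m z) (g *m x) = g *m jop j z x.

Lemma sym_part_isometry x y :
  sym_part j' (g *m x) (g *m y) = g *m sym_part j x y.
Proof. by rewrite /sym_part !g_jop -mulmxDr scalemxAr. Qed.

Lemma nab_isometry x y : nab j' (g *m x) (g *m y) = g *m nab j x y.
Proof. by rewrite /nab g_br sym_part_isometry scalemxAr -mulmxDr. Qed.

Lemma second_cov_isometry x y z :
  second_cov j' (g *m x) (g *m y) (g *m z) = g *m second_cov j x y z.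
Proof.
rewrite /second_cov !g_br !sym_part_isometry nab_isometry.
by rewrite -mulmxDr scalemxAr -mulmxDr.
Qed.

(** g is an isomorphism of metric Lie algebras, and tau is made of the bracket,
    its transpose and the inner product. *)
Lemma tau_isometry k X : tau k j' (fun s => g *m X s) = tau k j X.
Proof.
elim: k X => [|k IHk] X /=.
  rewrite /curv_op !second_cov_isometry -mulmxN -mulmxDr.
  exact: dot_orthogonal.
congr (- _); apply: eq_bigr => i _; rewrite nab_isometry -IHk; congr tau.
by apply/funext => s; rewrite /upd_at; case: eqP.
Qed.

End Isometry.

Definition diagV (A : 'M[R]_m) : 'M[R]_(m + r) := block_mx A 0 0 1%:M.
Definition diagU (B : 'M[R]_r) : 'M[R]_(m + r) := block_mx 1%:M 0 0 B.

Lemma diagV_mul A (x : vec) : diagV A *m x = col_mx (A *m usubmx x) (dsubmx x).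
Proof.
by rewrite -{1}[x]vsubmxK mul_block_col !mul0mx addr0 add0r mul1mx.
Qed.

Lemma diagU_mul B (x : vec) : diagU B *m x = col_mx (usubmx x) (B *m dsubmx x).
Proof.
by rewrite -{1}[x]vsubmxK mul_block_col !mul0mx addr0 add0r mul1mx.
Qed.

Lemma diagV_orthogonal A : orthogonal_mx A -> orthogonal_mx (diagV A).
Proof.
move=> orthA; rewrite /orthogonal_mx tr_block_mx mulmx_block orthA.
by rewrite !trmx0 !(mul0mx, mulmx0) trmx1 mul1mx !addr0 add0r -scalar_mx_block.
Qed.

Lemma diagU_orthogonal B : orthogonal_mx B -> orthogonal_mx (diagU B).
Proof.
move=> orthB; rewrite /orthogonal_mx tr_block_mx mulmx_block orthB.
by rewrite !trmx0 !(mul0mx, mulmx0) trmx1 mul1mx !addr0 add0r -scalar_mx_block.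
Qed.

Lemma tau_twistV A j k X : orthogonal_mx A ->
  tau k (twistV A j) (fun s => diagV A *m X s) = tau k j X.
Proof.
move=> orthA; apply: tau_isometry; first exact: diagV_orthogonal.
- move=> x y; rewrite /br !diagV_mul !col_mxKu col_mxKd mulmx0; congr col_mx.
  apply/colP => a; rewrite !mxE /= /twistV -!mulmxA (mulmxA A^T) orthA mul1mx.
  exact: dot_orthogonal.
- move=> z x; rewrite /jop !diagV_mul !col_mxKu !col_mxKd; congr col_mx.
  by rewrite /= /twistV -!mulmxA (mulmxA A^T) orthA mul1mx.
Qed.

Lemma tau_twistU B j k X : orthogonal_mx B ->
  tau k (twistU B j) (fun s => diagU B *m X s) = tau k j X.
Proof.
move=> orthB; apply: tau_isometry; first exact: diagU_orthogonal.
- move=> x y; rewrite /br !diagU_mul !col_mxKu col_mxKd; congr col_mx.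
  apply/colP => a; rewrite !mxE /= /twistU brP /dot; apply: eq_bigr => c _.
  congr (_ * _); last by rewrite /br col_mxKd !mxE !col_mxKu.
  rewrite mxE (bigD1 a) //= !mxE !eqxx mulr1 big1 ?addr0 // => i /negPf ne.
  by rewrite !mxE ne mulr0.
- move=> z x; rewrite /jop !diagU_mul !col_mxKu !col_mxKd mulmx0; congr col_mx.
  by rewrite /= /twistU mulmxA orthB mul1mx.
Qed.

Lemma nth_cols_mul n k (g : 'M[R]_n) (b : 'M[R]_(n, k)) (t : seq 'I_k) s :
  nth 0 [seq col i (g *m b) | i <- t] s = g *m nth 0 [seq col i b | i <- t] s.
Proof.
elim: t s => [|i t IHt] [|s] //=; first by rewrite mulmx0.
  by rewrite mulmx0.
by rewrite !colE mulmxA.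
Qed.

Section Invariant.
Variables (q K : nat) (P : mpoly #|curv_var (m + r) K| R).
Hypothesis P_inv : curvature_invariant P.

(** The value of P on the components tau of the curvature tensor with respect to
    the columns of o, which stand for left invariant fields. *)
Definition frame_eval j (o : 'M[R]_(m + r)) := meval (fun i =>
  let x : curv_var (m + r) K := enum_val i in
  tau (tag x) j (fun s => nth 0 [seq col i o | i <- tagged x] s)) P.

Lemma curv_eval_frame j p b : so_valued j ->
  curv_eval P (gmetric j) p b = frame_eval j (theta_mx j p *m b).
Proof.
move=> soj; rewrite /curv_eval /frame_eval; congr meval; apply/funext => i.
rewrite /curv_coef /= tau_frame //; last by rewrite size_map size_tuple.
congr tau; apply/funext => s.
by rewrite nth_cols_mul theta_mxE.
Qed.

Lemma orthogonal_onb j p b :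
  onb (gmetric j) p b <-> orthogonal_mx (theta_mx j p *m b).
Proof. by rewrite /onb /orthogonal_mx gmetricE trmx_mul !mulmxA. Qed.

Lemma theta_mx0 j : theta_mx j 0 = 1%:M.
Proof.
apply/matrixP => i k; rewrite mxE /theta.
rewrite (linear_at0 (br_linl j _)) scaler0 subr0.
by rewrite !mxE eqxx andbT.
Qed.

(** At the unit every orthogonal matrix is an orthonormal basis, and P does not
    depend on the orthonormal basis there. *)
Lemma frame_eval_const j o : so_valued j -> orthogonal_mx o ->
  frame_eval j o = frame_eval j 1%:M.
Proof.
move=> soj oo.
have := P_inv (riemannian_gmetric j) (p := 0) (b := o) (b' := 1%:M).
rewrite !curv_eval_frame // theta_mx0 !mul1mx; apply.
  by apply/orthogonal_onb; rewrite theta_mx0 mul1mx.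
by apply/orthogonal_onb; rewrite theta_mx0 mul1mx /orthogonal_mx trmx1 mul1mx.
Qed.

(** The isometry g carries the standard basis for j to the basis g for j', which
    may be replaced by the standard one. *)
Lemma frame_eval_isometry j j' (g : 'M[R]_(m + r)) :
  so_valued j' -> orthogonal_mx g ->
  (forall k X, tau k j' (fun s => g *m X s) = tau k j X) ->
  frame_eval j' 1%:M = frame_eval j 1%:M.
Proof.
move=> soj' og tauE; rewrite -(frame_eval_const soj' og) /frame_eval.
congr meval; apply/funext => i /=; rewrite -tauE; congr tau.
by apply/funext => s; rewrite -nth_cols_mul mulmx1.
Qed.

Lemma homog_frame_eval : has_order P (2 * q)%N ->
  homog (2 * q) (fun j => frame_eval j 1%:M).
Proof.
move=> ordP.
apply: (@homog_ext _ _ _ _ (fun j => \sum_(mon <- msupp P) mcoeff mon P *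
  \prod_i (let x : curv_var (m + r) K := enum_val i in
   tau (tag x) j (fun s => nth 0 [seq col i 1%:M | i <- tagged x] s))
  ^+ mon i)).
  by move=> j; rewrite /frame_eval mevalE.
apply: homog_sum => mon mon_in; apply: homog_scale.
apply: homog_cast (ordP _ mon_in) _.
apply: homog_prod => i; apply: homog_exp; exact: homog_tau.
Qed.

End Invariant.

End Main.

Theorem proposition12 (R : realType) (m r q K : nat)
    (P : mpoly #|curv_var (m + r) K| R) :
  curvature_invariant P -> has_order P (2 * q)%N ->
  exists cs : seq (R * seq (seq 'I_q)),
    all (fun cw => admissible cw.2) cs /\
    forall j : {linear 'cV[R]_r -> 'M[R]_m}, so_valued j ->
    forall Z : 'I_r -> 'cV[R]_r, orthonormal Z ->
    forall (p : 'cV[R]_(m + r)) (b : 'M[R]_(m + r)), onb (gmetric j) p b ->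
    curv_eval P (gmetric j) p b
    = \sum_(cw <- cs) cw.1 * trace_inv j Z cw.2.
Proof.
move=> P_inv P_ord.
have [t tE] := homog_form (homog_frame_eval P_ord).
have {}tE j : frame_eval P j 1%:M = form_of t j := tE j.
have [A j oA soj|B j oB soj|cs [adm csE]] :=
    @invariant_form_expressible R m r (2 * q) q t erefl.
- rewrite -!tE; apply: (frame_eval_isometry P_inv (twistV_so A soj)
    (diagV_orthogonal _ oA)) => k X.
  exact: tau_twistV.
- rewrite -!tE; apply: (frame_eval_isometry P_inv (twistU_so B soj)
    (diagU_orthogonal _ oB)) => k X.
  exact: tau_twistU.
exists cs; split=> // j soj Z onZ p b onb_b.
rewrite curv_eval_frame // (frame_eval_const P_inv soj) ?tE;
  last exact/orthogonal_onb.
exact: csE.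
Qed.
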